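(* Let $X=(X,d,\mu)$ be an mm-space whose measure has full support, let $\rho>0$, and let $\mu^\rho$ be the measure on $X$ with density $d\mu^\rho(x)/d\mu(x)=\rho^2\mu(B_\rho(x))$. Let $r\ge\rho$ and $N=N_X(3r)$. Then $$\lambda_N(X,\rho)\le4\,Q(r)\,r^{-2},$$ where $$Q(r)=\sup_{x\in X}\frac{\mu^\rho(B_{2r}(x))}{\mu^\rho(B_{r/2}(x))}.$$
   Context: An mm-space is a triple $X=(X,d,\mu)$ where $(X,d)$ is a compact metric space and $\mu$ is a finite Borel measure on $X$. $B_r(x)=\{y: d(x,y)<r\}$. For $\rho>0$ the $\rho$-Laplacian $\Delta^\rho_X\colon L^2(X,\mu)\to L^2(X,\mu)$ is $$\Delta^\rho_X u(x)=\frac1{\rho^2\mu(B_\rho(x))}\int_{B_\rho(x)}(u(x)-u(y))\,d\mu(y).$$ It is a bounded, non-negative, self-adjoint operator with respect to the inner product of $L^2(X,\mu^\rho)$, i.e. $\langle u,v\rangle_{X^\rho}=\rho^2\int_X\mu(B_\rho(x))u(x)v(x)\,d\mu(x)$. The discrete spectrum is the set of isolated eigenvalues of finite multiplicity, and the essential spectrum is the rest of the spectrum. Let $\lambda_\infty(X,\rho)$ be the infimum of the essential spectrum of $\Delta^\rho_X$, with $\lambda_\infty=\infty$ if there is no essential spectrum (i.e. if $L^2(X)$ is finite-dimensional). Let $0=\lambda_1\le\lambda_2\le\dots$ be the eigenvalues of $\Delta^\rho_X$, counted with multiplicities, that are smaller than $\lambda_\infty$; if there are only finitely many of them, set $\lambda_k=\lambda_\infty$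 for all larger $k$. This defines $\lambda_k(X,\rho)\in[0,\infty]$ for all $k\in\mathbb N$. For $r>0$, $N_X(r)$ is the maximum number of points in an $r$-separated set in $X$, where $Y\subset X$ is $r$-separated if $d(y_1,y_2)\ge r$ for all distinct $y_1,y_2\in Y$. *)

(* Defs.v *)
From HB Require Import structures.
From mathcomp Require Export all_boot all_order all_algebra.
From mathcomp Require Export all_classical all_reals all_analysis.
Export Order.TTheory GRing.Theory Num.Theory numFieldNormedType.Exports.

Set Implicit Arguments.
Unset Strict Implicit.
Unset Printing Implicit Defensive.

Local Open Scope classical_set_scope.
Local Open Scope ring_scope.

(* Measurable types are pointed in MathComp-Analysis, hence so are the metric
   spaces considered here: [pmetricType R] is a nonempty metric space. *)
#[short(type=pmetricType)]
HB.structure Definition PMetric (R : numDomainType) :=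
  {X of Pointed X & Metric R X}.

Notation borel X := (g_sigma_algebraType (@open X)).

(* An operator on the real space L^2(T, mu) is given by its action
   A : (T -> R) -> (T -> R) on square-integrable functions, and elements of L^2
   are compared with almost everywhere equality. All operators below are
   self-adjoint, so that their spectrum is a set of real numbers. *)
Section L2_spectrum.
Context d (T : measurableType d) (R : realType).
Variables (mu : {measure set T -> \bar R}) (A : (T -> R) -> T -> R).

Local Notation L2 := (Lfun mu 2%:E).
Local Notation norm2 u := (Lnorm mu 2%:E (EFin \o u)).

Definition shifted (lambda : R) (u : T -> R) : T -> R :=
  fun x => A u x - lambda * u x.

(* A - lambda is a bijection of L^2 with bounded inverse *)
Definition in_resolvent (lambda : R) :=
  [/\ (forall u v, u \in L2 -> v \in L2 ->
         shifted lambda u = shifted lambda v %[ae mu] -> u = v %[ae mu]),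
      (forall f, f \in L2 ->
         exists2 u, u \in L2 & shifted lambda u = f %[ae mu])
    & exists C : R, forall u, u \in L2 ->
         (norm2 u <= C%:E * norm2 (shifted lambda u))%E].

Definition spectrum : set R := [set lambda | ~ in_resolvent lambda].

Definition eigenspace (lambda : R) : set (T -> R) :=
  [set u | u \in L2 /\ A u = (fun x => lambda * u x) %[ae mu]].

Definition is_eigenvalue (lambda : R) :=
  exists2 u, eigenspace lambda u & ~ (u = cst 0 %[ae mu]).

Definition ae_free n (u : 'I_n -> T -> R) := forall c : 'I_n -> R,
  (fun x => \sum_(i < n) c i * u i x) = cst 0 %[ae mu] -> forall i, c i = 0.

(* dimension of the eigenspace, +oo when it is infinite-dimensional *)
Definition multiplicity (lambda : R) : \bar R :=
  ereal_sup [set n%:R%:E | n in [set n : nat |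
    exists2 u : 'I_n -> T -> R, (forall i, eigenspace lambda (u i))
                              & ae_free u]].

Definition discrete_spectrum : set R := [set lambda |
  [/\ is_eigenvalue lambda, ~ limit_point spectrum lambda
    & (multiplicity lambda < +oo)%E]].

Definition essential_spectrum : set R := spectrum `\` discrete_spectrum.

(* +oo if the essential spectrum is empty *)
Definition lambda_infty : \bar R :=
  ereal_inf [set lambda%:E | lambda in essential_spectrum].

(* number of eigenvalues in S, counted with multiplicities *)
Definition eigenvalue_count (S : set R) : \bar R :=
  \esum_(s in S `&` is_eigenvalue) multiplicity s.

(* [eigenvalue_at k t]: t occupies the k-th position (counted from 1) in the
   nondecreasing list, with multiplicities, of the eigenvalues smaller than
   lambda_infty, that is, fewer than k eigenvalues are < t and at least k
   are <= t. *)
Definition eigenvalue_at (k : nat) (t : R) :=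
  [/\ is_eigenvalue t, (t%:E < lambda_infty)%E,
      (eigenvalue_count [set s | (s < t)%R] < k%:R%:E)%E
    & (k%:R%:E <= eigenvalue_count [set s | (s <= t)%R])%E].

(* Meaningful for 0 < k only. *)
Definition lambda_ (k : nat) : \bar R :=
  xget lambda_infty [set t%:E | t in eigenvalue_at k].

End L2_spectrum.

Section mm_space.
Context (R : realType) (X : pmetricType R).
Variable mu : {finite_measure set (borel X) -> \bar R}.

Definition full_support :=
  forall U : set X, open U -> U !=set0 -> (0 < mu U)%E.

Definition rho_laplacian (rho : R) (u : borel X -> R) (x : borel X) : R :=
  (rho ^+ 2 * fine (mu (ball (x : X) rho)))^-1 *
  \int[mu]_(y in ball (x : X) rho) (u x - u y).

(* the measure with density rho^2 mu(B_rho(x)) with respect to mu *)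
Definition mu_rho (rho : R) (E : set (borel X)) : \bar R :=
  (\int[mu]_(x in E) ((rho ^+ 2)%:E * mu (ball (x : X) rho)))%E.

Definition Q (rho r : R) : \bar R :=
  ereal_sup (range (fun x : X =>
    (mu_rho rho (ball x (2 * r)) / mu_rho rho (ball x (r / 2)))%E)).

End mm_space.

Definition separated_set (R : realType) (X : metricType R) (r : R)
    (Y : set X) :=
  forall y1 y2, Y y1 -> Y y2 -> y1 <> y2 -> r <= mdist y1 y2.

(* When X is compact and 0 < r, the sizes of the r-separated sets are bounded
   and this supremum in nat is a maximum. *)
Definition packing_number (R : realType) (X : metricType R) (r : R) : nat :=
  supremum 0%N [set n | exists2 Y : set X, separated_set r Y & (Y #= `I_n)%card].

(* Main.v *)
(* [L^2] is used with the inner product [<u, v> = \int w u v], where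
   [w x = mu (B_rho x)]; it makes the rho-Laplacian [A] self-adjoint with
   [2 rho^2 <A u, u> = \iint_{d(x, y) < rho} (u x - u y)^2].

   Let [m] be the infimum of the Rayleigh quotient of [A] on a closed invariant
   subspace [H]. By Cauchy-Schwarz for the form of [A - m], [m] is an approximate
   eigenvalue. If [m < lambda_infty], then [m] is isolated in the spectrum, so
   that [T = A - m] satisfies [|T u|^2 >= g <T u, u>] on [H] for some [g > 0];
   then the iterates of [1 - T / K] converge to the projection onto the kernel of
   [T], which is nonzero since [m] is an infimum. Applied to the orthogonal
   complements of the eigenvectors already found, this gives the lower bound of
   the min-max principle: if the Rayleigh quotient is at most [Lam] on a space of
   dimension [n], then [lambda_n <= Lam].

   The test space is spanned by the bumps [max (0, 1 - d(y_i, .) / r)] at the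
   points of a maximal [3 r]-separated set: points in the supports of different
   bumps are at distance greater than [r >= rho], so that both the energy and the
   norm are diagonal in these bumps. *)
Require Import Defs.
From mathcomp Require Import measurable_realfun ring lra.

Set Implicit Arguments.
Unset Strict Implicit.
Unset Printing Implicit Defensive.

Local Open Scope classical_set_scope.
Local Open Scope ring_scope.

(** * Self-adjoint operators on a semi-inner product space *)

Section semi_inner_product.
Context (R : realType) (V : lmodType R).
Implicit Types (b : V -> V -> R) (H : set V) (T : V -> V) (u v : V).

Definition symmetric_bilinear b :=
  (forall u v, b u v = b v u) /\
  (forall a u v w, b (a *: u + v) w = a * b u w + b v w).

Definition lin_subspace H := H 0 /\ forall a u v, H u -> H v -> H (a *: u + v).

Lemma lin_subspaceZ H a u : lin_subspace H -> H u -> H (a *: u).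
Proof. by case=> H0 HD Hu; rewrite -[a *: u]addr0; exact: HD. Qed.

Lemma lin_subspaceB H a u v : lin_subspace H -> H u -> H v -> H (u - a *: v).
Proof. by case=> H0 HD Hu Hv; rewrite addrC -scaleNr; exact: HD. Qed.

Section bilinear.
Variables (b : V -> V -> R) (sb : symmetric_bilinear b).

Lemma bilC u v : b u v = b v u. Proof. exact: sb.1. Qed.

Lemma bil0l u : b 0 u = 0.
Proof.
have := sb.2 1 0 0 u; rewrite scaler0 addr0 mul1r => /eqP.
by rewrite -subr_eq0 opprD addrA subrr sub0r oppr_eq0 => /eqP.
Qed.

Lemma bilDl u v w : b (u + v) w = b u w + b v w.
Proof. by rewrite -[u]scale1r sb.2 scale1r mul1r. Qed.

Lemma bilZl a u w : b (a *: u) w = a * b u w.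
Proof. by rewrite -[a *: u]addr0 sb.2 bil0l addr0. Qed.

Lemma bilBl u v w : b (u - v) w = b u w - b v w.
Proof. by rewrite -scaleN1r bilDl bilZl mulN1r. Qed.

Lemma bilZr a w u : b w (a *: u) = a * b w u.
Proof. by rewrite ![b w _]bilC bilZl. Qed.

Lemma bilBr w u v : b w (u - v) = b w u - b w v.
Proof. by rewrite ![b w _]bilC bilBl. Qed.

Lemma bil_suml (I : Type) (s : seq I) (P : pred I) (F : I -> V) w :
  b (\sum_(i <- s | P i) F i) w = \sum_(i <- s | P i) b (F i) w.
Proof.
elim/big_rec2: _ => [|i x y _ <-]; [exact: bil0l | exact: bilDl].
Qed.

Lemma bil_sqrB t u v :
  b (u - t *: v) (u - t *: v) = b u u - 2 * t * b u v + t ^+ 2 * b v v.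
Proof. rewrite bilBl !bilBr !bilZl !bilZr (bilC v u); ring. Qed.

(** The form may be degenerate, and is non-negative on [H] only. Positivity is tested at
    [u - t *: v] for a suitable [t]. *)
Lemma cauchy_schwarz H u v : lin_subspace H -> (forall w, H w -> 0 <= b w w) ->
  H u -> H v -> b u v ^+ 2 <= b u u * b v v.
Proof.
move=> sH b_ge0 Hu Hv.
have bt t : 0 <= b u u - 2 * t * b u v + t ^+ 2 * b v v.
  by rewrite -bil_sqrB; apply: b_ge0; exact: lin_subspaceB.
have [bv0|bv0] := eqVneq (b v v) 0.
  rewrite bv0 mulr0; have [->|buv0] := eqVneq (b u v) 0; first by rewrite expr0n.
  (* When [b v v = 0] the quadratic in [t] is affine, and this [t] gives it the value [-1]. *)
  have := bt ((b u u + 1) / (2 * b u v)); rewrite bv0.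
  have -> : b u u - 2 * ((b u u + 1) / (2 * b u v)) * b u v +
    ((b u u + 1) / (2 * b u v)) ^+ 2 * 0 = - 1 by field.
  lra.
have bv_gt0 : 0 < b v v by rewrite lt0r bv0 b_ge0.
have := bt (b u v / b v v).
have -> : b u u - 2 * (b u v / b v v) * b u v + (b u v / b v v) ^+ 2 * b v v =
  (b u u * b v v - b u v ^+ 2) / b v v by field.
by rewrite pmulr_lge0 ?invr_gt0// subr_ge0.
Qed.

(** Positivity at [u - 2 *: v]; the companion upper bound uses [u + v]. *)
Lemma sqrB_ge H u v : lin_subspace H -> (forall w, H w -> 0 <= b w w) ->
  H u -> H v -> b u u / 2 - b v v <= b (u - v) (u - v).
Proof.
move=> sH b_ge0 Hu Hv; have := b_ge0 _ (lin_subspaceB 2 sH Hu Hv).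
by rewrite bil_sqrB -[v in X in _ -> _ <= X]scale1r bil_sqrB; lra.
Qed.

Lemma sqrB_le H u v : lin_subspace H -> (forall w, H w -> 0 <= b w w) ->
  H u -> H v -> b (u - v) (u - v) <= 2 * b u u + 2 * b v v.
Proof.
move=> sH b_ge0 Hu Hv; have := b_ge0 _ (lin_subspaceB (-1) sH Hu Hv).
by rewrite bil_sqrB -[v in X in _ -> X <= _]scale1r bil_sqrB; lra.
Qed.

End bilinear.

Variable ip : V -> V -> R.
Hypothesis ip_sb : symmetric_bilinear ip.
Hypothesis ip_ge0 : forall u, 0 <= ip u u.

Let normB_le u v : ip (u - v) (u - v) <= 2 * ip u u + 2 * ip v v.
Proof. by apply: (sqrB_le ip_sb (H := setT)). Qed.

Definition self_adjoint T :=
  linear T /\ forall u v, ip (T u) v = ip u (T v).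

Definition op_shift T (c : R) : V -> V := fun u => T u - c *: u.

Lemma self_adjoint_op_shift T c : self_adjoint T -> self_adjoint (op_shift T c).
Proof.
move=> [linT symT]; split=> [a u v|u v]; rewrite /op_shift.
  rewrite linT scalerBr !scalerDr opprD !scalerA (mulrC c).
  by rewrite addrACA.
by rewrite (bilBl ip_sb) (bilBr ip_sb) symT (bilZl ip_sb) (bilZr ip_sb).
Qed.

Lemma self_adjoint_sqr T : self_adjoint T -> self_adjoint (T \o T).
Proof. by move=> [linT symT]; split=> [a u v|u v] /=; rewrite ?linT// !symT. Qed.

Lemma form_sb T : self_adjoint T -> symmetric_bilinear (fun u v => ip (T u) v).
Proof.
move=> [linT symT]; split=> [u v|a u v w].
  by rewrite symT (bilC ip_sb).
by rewrite linT ip_sb.2.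
Qed.

Definition stable_under H T := forall u, H u -> H (T u).

Lemma stable_op_shift H T c :
  lin_subspace H -> stable_under H T -> stable_under H (op_shift T c).
Proof. by move=> sH iH u Hu; apply: lin_subspaceB => //; exact: iH. Qed.

(* Cauchy-Schwarz for the form [<T u, v>], with [v = T u] *)
Lemma norm_le_form H T (K : R) : lin_subspace H -> self_adjoint T -> stable_under H T ->
  (forall u, H u -> 0 <= ip (T u) u) ->
  (forall u, H u -> ip (T u) u <= K * ip u u) ->
  forall u, H u -> ip (T u) (T u) <= K * ip (T u) u.
Proof.
move=> sH saT iT T_ge0 T_le u Hu.
have := cauchy_schwarz (form_sb saT) sH T_ge0 Hu (iT _ Hu) => /= CS.
have TT := T_le _ (iT _ Hu).
have [Tu0|Tu0] := eqVneq (ip (T u) (T u)) 0.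
  have := cauchy_schwarz ip_sb (H := setT) (u := T u) (v := u).
  rewrite Tu0 mul0r => /(_ (conj I (fun _ _ _ _ _ => I)) (fun w _ => ip_ge0 w) I I).
  by rewrite le_eqVlt ltNge sqr_ge0 orbF sqrf_eq0 => /eqP ->; rewrite mulr0.
have Tu_gt0 : 0 < ip (T u) (T u) by rewrite lt0r Tu0 ip_ge0.
rewrite -(ler_pM2r Tu_gt0) -expr2; apply: (le_trans CS).
by rewrite -mulrA mulrCA ler_wpM2l// T_ge0.
Qed.

(** Weyl's criterion in terms of squared norms, with approximate eigenvectors taken in [H]. *)
Definition approx_eigenvalue H T (c : R) := forall e, 0 < e ->
  exists u, [/\ H u, 0 < ip u u & ip (op_shift T c u) (op_shift T c u) <= e * ip u u].

(** With [m] the infimum of the Rayleigh quotients, [T - m] has a non-negative bounded form on [H],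
    so [norm_le_form] turns a nearly minimal quotient into an approximate eigenvector. *)
Lemma rayleigh_inf H T (a b : R) :
  lin_subspace H -> self_adjoint T -> stable_under H T ->
  (exists2 u, H u & 0 < ip u u) ->
  (forall u, H u -> a * ip u u <= ip (T u) u) ->
  (forall u, H u -> ip (T u) u <= b * ip u u) ->
  exists m, [/\ a <= m, forall u, H u -> m * ip u u <= ip (T u) u
              & approx_eigenvalue H T m].
Proof.
move=> sH saT iT [u0 Hu0 u0_gt0] aT Tb.
pose S := [set ip (T u) u / ip u u | u in [set u | H u /\ 0 < ip u u]].
have lbS : lbound S a.
  by move=> _ [u [Hu u_gt0] <-]; rewrite ler_pdivlMr// aT.
have infS : has_inf S.
  by split; [exists (ip (T u0) u0 / ip u0 u0), u0 | exists a].
pose m := inf S.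
have am : a <= m by apply: lb_le_inf => //; case: infS.
have mT u : H u -> m * ip u u <= ip (T u) u.
  move=> Hu; have [u_eq0|u_neq0] := eqVneq (ip u u) 0.
    by rewrite u_eq0 mulr0; have := aT u Hu; rewrite u_eq0 mulr0.
  have u_gt0 : 0 < ip u u by rewrite lt0r u_neq0 ip_ge0.
  rewrite -ler_pdivlMr//; apply: ge_inf; last by exists u.
  by exists a.
exists m; split=> // e e_gt0.
have saTm := self_adjoint_op_shift m saT.
have iTm := @stable_op_shift H T m sH iT.
have Tm_ge0 u : H u -> 0 <= ip (op_shift T m u) u.
  by move=> Hu; rewrite (bilBl ip_sb) (bilZl ip_sb) subr_ge0 mT.
(* The summand [1] keeps [K] positive even when [b = m]. *)
pose K := `|b - m| + 1.
have K_gt0 : 0 < K by rewrite ltr_pwDr.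
have Tm_le u : H u -> ip (op_shift T m u) u <= K * ip u u.
  move=> Hu; rewrite (bilBl ip_sb) (bilZl ip_sb).
  have := Tb u Hu; have := ler_norm (b - m); have := ip_ge0 u.
  by rewrite /K; nra.
have [_ [u [Hu u_gt0] <-] ult] := inf_adherent (divr_gt0 e_gt0 K_gt0) infS.
exists u; split=> //.
apply: (le_trans (norm_le_form sH saTm iTm Tm_ge0 Tm_le Hu)).
have : ip (op_shift T m u) u <= e / K * ip u u.
  rewrite (bilBl ip_sb) (bilZl ip_sb) lerBlDl -mulrDl -ler_pdivrMr//.
  exact: ltW.
rewrite -(ler_pM2l K_gt0) => /le_trans; apply.
by rewrite mulrA mulrCA divff ?mulr1// gt_eqF.
Qed.

(* The quadratic form of [(T - c)^2] attains its infimum [s^2] approximately, and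
   [(T - c)^2 - s^2 = (T - c - s) (T - c + s)]. *)
Lemma shift_norm_inf H T (c b : R) :
  lin_subspace H -> self_adjoint T -> stable_under H T ->
  (exists2 u, H u & 0 < ip u u) ->
  (forall u, H u -> ip (T u) (T u) <= b * ip u u) ->
  exists s, [/\ 0 <= s,
    forall u, H u -> s ^+ 2 * ip u u <= ip (op_shift T c u) (op_shift T c u)
    & approx_eigenvalue H T (c - s) \/ approx_eigenvalue H T (c + s)].
Proof.
move=> sH saT iT exu Tb.
have saTc := self_adjoint_op_shift c saT.
have iTc := @stable_op_shift H T c sH iT.
have Tc2E u : ip ((op_shift T c \o op_shift T c) u) u =
    ip (op_shift T c u) (op_shift T c u).
  by rewrite /= saTc.2.
have [||||s2 [s2_ge0 s2P s2_approx]] := @rayleigh_inf H (op_shift T c \o op_shift T c)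
  0 (2 * b + 2 * c ^+ 2) sH (self_adjoint_sqr saTc).
- by move=> u Hu; exact: (iTc _ (iTc _ Hu)).
- exact: exu.
- by move=> u Hu; rewrite Tc2E mul0r ip_ge0.
- move=> u Hu; rewrite Tc2E; have := normB_le (T u) (c *: u).
  rewrite (bilZl ip_sb c) (bilZr ip_sb c); have := Tb u Hu.
  by rewrite -/(op_shift T c u); nra.
pose s := Num.sqrt s2.
have s2E : s ^+ 2 = s2 by rewrite sqr_sqrtr.
exists s; split; [exact: sqrtr_ge0 | by move=> u Hu; rewrite s2E -Tc2E s2P |].
have [|/existsNP[e0 /not_implyP[e0_gt0 Ne0]]] :=
  pselect (approx_eigenvalue H T (c - s)); first by left.
(* Since [c - s] fails at level [e0], the vector [v] below has squared norm greater than
   [d * ip u u], while its image under [T - c - s] is the image of [u] under [(T - c)^2 - s^2], of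
   squared norm at most [d * d * ip u u]. *)
right=> e e_gt0; pose d := Num.min e e0.
have d_gt0 : 0 < d by rewrite lt_min e_gt0.
have [u [Hu u_gt0 uP]] := s2_approx (d * d) (mulr_gt0 d_gt0 d_gt0).
pose v := op_shift T (c - s) u.
have v_gt : d * ip u u < ip v v.
  rewrite ltNge; apply/negP => vle; apply: Ne0; exists u; split=> //.
  by apply: (le_trans vle); rewrite ler_wpM2r// ge_min lexx orbT.
exists v; split; first exact: (@stable_op_shift H T (c - s) sH iT _ Hu).
  by apply: le_lt_trans v_gt; rewrite mulr_ge0// ltW.
have -> : op_shift T (c + s) v = op_shift (op_shift T c \o op_shift T c) s2 u.
  have TD a x y : T (a *: x + y) = a *: T x + T y by exact: saT.1.
  have TB a x y : T (x - a *: y) = T x - a *: T y.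
    by rewrite -!scaleNr addrC TD addrC.
  have comb (x y z : V) (p q : R) :
      x - p *: y - q *: (y - p *: z) = x - (p + q) *: y + (q * p) *: z.
    by rewrite scalerBr scalerA opprB scalerDl opprD [_ *: z - _]addrC !addrA.
  rewrite /v /op_shift /= !TB !comb -s2E -[RHS]addrA -scalerBl.
  by congr (_ - _ *: _ + _ *: _); ring.
apply: (le_trans uP); rewrite -mulrA; apply: (@le_trans _ _ (d * ip v v)).
  by rewrite ler_pM2l// ltW.
by rewrite ler_wpM2r// ge_min lexx.
Qed.

Lemma ip_null u v : ip v v = 0 -> ip u v = 0.
Proof.
move=> v0; have := cauchy_schwarz ip_sb (H := setT) (u := u) (v := v).
rewrite v0 mulr0 => /(_ (conj I (fun _ _ _ _ _ => I)) (fun w _ => ip_ge0 w) I I).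
by rewrite le_eqVlt ltNge sqr_ge0 orbF sqrf_eq0 => /eqP.
Qed.

(** Apply [shift_norm_inf] at the centre [m + g] of the gap: [s < g] would put an approximate
    eigenvalue inside it. Expanding [|(T - m - g) u|^2 >= g^2 |u|^2] then gives the bound. *)
Lemma gap_form H T (b m g : R) : lin_subspace H -> self_adjoint T -> stable_under H T ->
  (exists2 u, H u & 0 < ip u u) ->
  (forall u, H u -> ip (T u) (T u) <= b * ip u u) ->
  0 < g -> (forall c, m < c -> c < m + 2 * g -> ~ approx_eigenvalue H T c) ->
  forall u, H u ->
    2 * g * ip (op_shift T m u) u <= ip (op_shift T m u) (op_shift T m u).
Proof.
move=> sH saT iT exu Tb g_gt0 gap u Hu.
have [s [s_ge0 sP s_approx]] := shift_norm_inf (m + g) sH saT iT exu Tb.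
have gs : g <= s.
  by rewrite leNgt; apply/negP => sg; case: s_approx; apply: gap; lra.
have -> : ip (op_shift T m u) (op_shift T m u) = ip (op_shift T (m + g) u)
    (op_shift T (m + g) u) + 2 * g * ip (op_shift T m u) u - g ^+ 2 * ip u u.
  have -> : op_shift T (m + g) u = op_shift T m u - g *: u.
    by rewrite /op_shift scalerDl opprD addrA.
  rewrite (bil_sqrB ip_sb g); ring.
have := sP u Hu; have := ip_ge0 u.
have : g ^+ 2 <= s ^+ 2 by rewrite lerXn2r// nnegrE// ltW.
nra.
Qed.

(** Completeness restricted to geometrically decaying increments, the only case needed; [C * q ^+ n]
    bounds squared norms, and limits are determined only up to null vectors. *)
Definition geometric_complete H := forall (v : nat -> V) (C q : R),
  (forall n, H (v n)) -> 0 <= q < 1 ->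
  (forall n, ip (v n.+1 - v n) (v n.+1 - v n) <= C * q ^+ n) ->
  exists2 w, H w & forall e, 0 < e ->
    exists N, forall n, (N <= n)%N -> ip (v n - w) (v n - w) <= e.

(* The iterates [(1 - T / K)^n u] converge geometrically to the component of [u]
   in the kernel of [T]; when it vanishes, [u] is a limit of elements of the range
   of [T], on which the form of [T] is bounded below by [g]. *)
Lemma kernel_or_coercive H T (K g : R) :
  lin_subspace H -> self_adjoint T -> stable_under H T -> geometric_complete H ->
  (forall u, H u -> 0 <= ip (T u) u) ->
  (forall u, H u -> ip (T u) u <= K * ip u u) ->
  0 < g <= K -> (forall u, H u -> g * ip (T u) u <= ip (T u) (T u)) ->
  (exists u, [/\ H u, 0 < ip u u & ip (T u) (T u) = 0]) \/
  (forall u, H u -> g / 16 * ip u u <= ip (T u) u).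
Proof.
move=> sH saT iT cH T_ge0 T_le /andP[g_gt0 gK] gT.
have [|noker] := pselect (exists u, [/\ H u, 0 < ip u u & ip (T u) (T u) = 0]).
  by left.
right=> u Hu.
have K_gt0 : 0 < K by exact: lt_le_trans gK.
have TK := norm_le_form sH saT iT T_ge0 T_le.
have TB a x y : T (x - a *: y) = T x - a *: T y.
  by rewrite -!scaleNr addrC saT.1 addrC.
(* By Cauchy-Schwarz for the form of [T], [|T x|^4 <= <T x, x> <T (T x), T x>], and
   [g <T x, x> <= |T x|^2]. *)
have grange x : H x -> g * ip (T x) (T x) <= ip (T (T x)) (T x).
  move=> Hx; have HTx := iT _ Hx.
  have [Tx0|Tx0] := eqVneq (ip (T x) (T x)) 0.
    by rewrite Tx0 mulr0 T_ge0.
  have Tx_gt0 : 0 < ip (T x) (T x) by rewrite lt0r Tx0 ip_ge0.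
  have /= CS := cauchy_schwarz (form_sb saT) sH T_ge0 Hx HTx.
  rewrite -(ler_pM2r Tx_gt0) -mulrA -expr2.
  apply: (@le_trans _ _ (g * (ip (T x) x * ip (T (T x)) (T x)))).
    by rewrite ler_wpM2l// ltW.
  by rewrite mulrA [leRHS]mulrC ler_wpM2r// ?gT// T_ge0.
pose S x := x - K^-1 *: T x.
have HS x : H x -> H (S x) by move=> Hx; apply: lin_subspaceB => //; exact: iT.
pose q := 1 - g / K.
have q01 : 0 <= q < 1.
  rewrite /q subr_ge0 ler_pdivrMr// mul1r gK/=.
  by rewrite ltrBlDr ltrDl divr_gt0.
(* [S = 1 - T / K] contracts squared norms on the range of [T] by the factor [q = 1 - g / K]: the
   lower bound [grange] and the upper bound [TK] are both used. *)
have Srange x : H x -> ip (S (T x)) (S (T x)) <= q * ip (T x) (T x).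
  move=> Hx; rewrite (bil_sqrB ip_sb).
  have := TK _ (iT _ Hx); have := grange _ Hx.
  rewrite (bilC ip_sb (T x)).
  set a := ip (T x) (T x); set c := ip (T (T x)) (T (T x)).
  set d := ip (T (T x)) (T x) => ga cK.
  have -> : a - 2 * K^-1 * d + K^-1 ^+ 2 * c =
      q * a - K^-1 * (d - g * a) - K^-1 ^+ 2 * (K * d - c).
    by rewrite /q; field; rewrite gt_eqF.
  have : 0 <= K^-1 * (d - g * a) by rewrite mulr_ge0 ?subr_ge0// invr_ge0 ltW.
  have : 0 <= K^-1 ^+ 2 * (K * d - c) by rewrite mulr_ge0 ?sqr_ge0// subr_ge0.
  lra.
pose v n := iter n S u.
have Hv n : H (v n) by elim: n => //= n IHn; exact: HS.
have Tv n : ip (T (v n)) (T (v n)) <= ip (T u) (T u) * q ^+ n.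
  elim: n => [|n IHn]; first by rewrite mulr1.
  have -> : T (v n.+1) = S (T (v n)) by rewrite /v /= {1}/S TB.
  apply: (le_trans (Srange _ (Hv n))).
  rewrite exprS mulrCA ler_wpM2l//; by case/andP: q01.
have dv n : v n.+1 - v n = - K^-1 *: T (v n).
  by rewrite /v /= {1}/S addrC addrA addNr add0r scaleNr.
have [||w Hw limw] := cH v (K^-1 ^+ 2 * ip (T u) (T u)) q Hv.
- exact: q01.
- move=> n; rewrite dv (bilZl ip_sb) (bilZr ip_sb) mulrA mulrNN -expr2 -[leRHS]mulrA.
  by rewrite ler_wpM2l ?sqr_ge0.
have HB x y : H x -> H y -> H (x - y).
  by move=> Hx Hy; rewrite -[y]scale1r; exact: lin_subspaceB.
have Tw0 : ip (T w) (T w) = 0.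
  apply/eqP; rewrite eq_le ip_ge0 andbT; apply/ler_addgt0Pr => e e_gt0.
  rewrite add0r.
  (* As [T (v N) = K (v N - v N.+1)] and [T] has norm at most [K], [|T w|^2] is at most
     [2 * 4 + 2 = 10] times [K ^+ 2] times the accuracy of the approximation of [w]. *)
  have e'_gt0 : 0 < e / (10 * K ^+ 2) by rewrite divr_gt0// mulr_gt0// exprn_gt0.
  have [N limN] := limw _ e'_gt0.
  have := limN N (leqnn N); have := limN N.+1 (leqnSn N).
  set x := v N - w; set y := v N.+1 - w => yP xP.
  have Tx : ip (T x) (T x) <= K ^+ 2 * ip x x.
    have Hx : H x by exact: HB.
    apply: (le_trans (TK _ Hx)); rewrite expr2 -mulrA ler_wpM2l ?T_le//.
    exact: ltW.
  have TvN : T (v N) = K *: (x - y).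
    have -> : x - y = - (v N.+1 - v N) by rewrite /x /y !opprB addrA subrK.
    by rewrite dv scaleNr opprK scalerA divff ?scale1r// gt_eqF.
  have -> : T w = T (v N) - T x.
    by rewrite -[x]/(v N - w) -[w in v N - w]scale1r TB scale1r opprB addrC subrK.
  apply: (le_trans (normB_le _ _)).
  rewrite TvN (bilZl ip_sb) (bilZr ip_sb).
  have xy := normB_le x y.
  have eE : e = 10 * K ^+ 2 * (e / (10 * K ^+ 2)).
    by field; rewrite gt_eqF.
  rewrite [leRHS]eE; set e' := e / _ in xP yP *.
  have K2_gt0 : 0 < K ^+ 2 by rewrite exprn_gt0.
  rewrite mulrA -expr2.
  have : K ^+ 2 * ip (x - y) (x - y) <= K ^+ 2 * (4 * e').
    by rewrite ler_pM2l//; lra.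
  have : K ^+ 2 * ip x x <= K ^+ 2 * e' by rewrite ler_pM2l.
  lra.
have w0 : ip w w = 0.
  apply/eqP; apply: contrapT => /negP w0; apply: noker; exists w; split=> //.
  by rewrite lt0r w0 ip_ge0.
(* Telescoping: each increment of [v] is a multiple of some [T (v n)]. *)
have rangev n : exists2 y, H y & u - v n = T y.
  elim: n => [|n [y Hy yE]].
    exists (0 *: u); first exact: lin_subspaceZ.
    have := TB 1 u u; rewrite !scale1r !subrr scale0r => ->.
    by [].
  exists (y - (- K^-1) *: v n); first exact: lin_subspaceB.
  by rewrite TB -yE -dv [- (v n.+1 - v n)]opprB [RHS]addrA subrK.
have [u0|u0] := eqVneq (ip u u) 0; first by rewrite u0 mulr0 T_ge0.
have u_gt0 : 0 < ip u u by rewrite lt0r u0 ip_ge0.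
(* The limit [w] is null, so [v N] becomes small; this accuracy makes the form of [T] at [v N] at
   most [g / 16 * ip u u]. *)
have e_gt0 : 0 < g / (32 * K) * ip u u.
  by rewrite mulr_gt0// divr_gt0// mulr_gt0.
have [N /(_ N (leqnn N)) limN] := limw _ e_gt0.
have vN : ip (v N) (v N) <= g / (16 * K) * ip u u.
  have := sqrB_ge ip_sb (H := setT) (u := v N) (v := w).
  move=> /(_ (conj I (fun _ _ _ _ _ => I)) (fun w _ => ip_ge0 w) I I).
  have -> : g / (16 * K) = 2 * (g / (32 * K)) by field; rewrite gt_eqF.
  rewrite w0; lra.
have [y Hy yE] := rangev N.
(* The form at [u - v N], an element of the range, is at least [g |u - v N|^2] and at most twice the
   sum of the forms at [u] and [v N]. *)
have := sqrB_le (form_sb saT) sH T_ge0 Hu (Hv N) => /=.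
have := grange _ Hy; rewrite -yE.
have := sqrB_ge ip_sb (H := setT) (u := u) (v := v N).
move=> /(_ (conj I (fun _ _ _ _ _ => I)) (fun w _ => ip_ge0 w) I I).
have := T_le _ (Hv N).
set uv := ip (u - v N) (u - v N); set U := ip u u in vN *.
set W := ip (v N) (v N) in vN * => h1 h2 h3 h4.
have h5 : K * W <= g / 16 * U.
  have -> : g / 16 * U = K * (g / (16 * K) * U) by field; rewrite gt_eqF.
  by rewrite ler_pM2l.
have h6 : g * W <= K * W by rewrite ler_wpM2r// ip_ge0.
have h7 : g * (U / 2 - W) <= g * uv by rewrite ler_pM2l.
have h8 : 0 <= g * U by rewrite mulr_ge0// ltW.
lra.
Qed.

(** * Successive minimisation of the Rayleigh quotient *)

Section min_max.
Variables (A : V -> V) (K Lam : R).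
Hypotheses (saA : self_adjoint A) (A_ge0 : forall u, 0 <= ip (A u) u).
Hypothesis A_le : forall u, ip (A u) u <= K * ip u u.
Hypothesis cV : geometric_complete setT.
Hypothesis gapA : forall m, m <= Lam -> approx_eigenvalue setT A m ->
  exists2 g, 0 < g &
    forall c, m < c -> c < m + 2 * g -> ~ approx_eigenvalue setT A c.

Let subT : lin_subspace setT. Proof. by []. Qed.

(** The infimum [m] on [H] is an approximate eigenvalue at most [Lam], so a gap lies above it. By
    [kernel_or_coercive], either [A - m] has a non-null kernel vector, which is normalised, or its
    form is coercive, which contradicts the approximate eigenvectors. *)
Lemma min_eigenvector H : lin_subspace H -> stable_under H A -> geometric_complete H ->
  (exists u, [/\ H u, 0 < ip u u & ip (A u) u <= Lam * ip u u]) ->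
  exists m e, [/\ m <= Lam, H e, ip e e = 1,
    ip (op_shift A m e) (op_shift A m e) = 0
    & forall u, H u -> m * ip u u <= ip (A u) u].
Proof.
move=> sH iA cH [u0 [Hu0 u0_gt0 u0Lam]].
have exu : exists2 u, H u & 0 < ip u u by exists u0.
have [||m [m_ge0 mP m_approx]] := rayleigh_inf (a := 0) (b := K) sH saA iA exu.
- by move=> u _; rewrite mul0r A_ge0.
- by move=> u _; exact: A_le.
have mLam : m <= Lam.
  by rewrite -(ler_pM2r u0_gt0); apply: le_trans u0Lam; exact: mP.
have approxT c : approx_eigenvalue H A c -> approx_eigenvalue setT A c.
  by move=> Hc e /Hc[u [_ ? ?]]; exists u.
have [g g_gt0 gapm] := gapA mLam (approxT _ m_approx).
have A_norm u : ip (A u) (A u) <= K * ip (A u) u.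
  by apply: (norm_le_form subT saA) => //.
have A_norm2 u : ip (A u) (A u) <= K ^+ 2 * ip u u.
  apply: (le_trans (A_norm u)).
  have K_ge0 : 0 <= K by have := A_le u0; have := A_ge0 u0; nra.
  by rewrite expr2 -mulrA ler_wpM2l.
have gf := gap_form sH saA iA exu (fun u _ => A_norm2 u) g_gt0
  (fun c h1 h2 h3 => gapm c h1 h2 (approxT _ h3)).
have saT := self_adjoint_op_shift m saA.
have iT := @stable_op_shift H A m sH iA.
have T_ge0 u : H u -> 0 <= ip (op_shift A m u) u.
  by move=> Hu; rewrite (bilBl ip_sb) (bilZl ip_sb) subr_ge0 mP.
(* The extra [2 * g] makes the upper bound at least the gap, as [kernel_or_coercive] requires. *)
have T_le u : H u -> ip (op_shift A m u) u <= (`|K| + 2 * g) * ip u u.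
  move=> Hu; rewrite (bilBl ip_sb) (bilZl ip_sb).
  by have := A_le u; have := ler_norm K; have := ip_ge0 u; nra.
have gK : 0 < 2 * g <= `|K| + 2 * g.
  by have := normr_ge0 K; move=> ?; apply/andP; split; lra.
have [[u [Hu u_gt0 Tu0]]|coer] :=
    kernel_or_coercive sH saT iT cH T_ge0 T_le gK gf.
  pose a := (Num.sqrt (ip u u))^-1.
  have a2 : a * a = (ip u u)^-1 by rewrite -expr2 exprVn sqr_sqrtr.
  exists m, (a *: u); split=> //.
  - exact: lin_subspaceZ.
  - by rewrite (bilZl ip_sb) (bilZr ip_sb) mulrA a2 mulVf// gt_eqF.
  - have -> : op_shift A m (a *: u) = a *: op_shift A m u.
      have [linT _] := saT.
      have T0 : op_shift A m 0 = 0.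
        by have := linT (-1) 0 0; rewrite scaler0 addr0 scaleN1r addNr.
      by have := linT a u 0; rewrite T0 !addr0.
    by rewrite (bilZl ip_sb) (bilZr ip_sb) Tu0 !mulr0.
(* Coercivity holds with constant [2 * g / 16], while at this level Cauchy-Schwarz bounds the form
   by [g / 16 * ip u u]. *)
have [|u [Hu u_gt0 uP]] := m_approx ((g / 16) ^+ 2).
  by rewrite exprn_gt0// divr_gt0.
have := cauchy_schwarz ip_sb (H := setT) (u := op_shift A m u) (v := u).
move=> /(_ subT (fun w _ => ip_ge0 w) I I).
have := coer u Hu; move: uP u_gt0.
set x := ip (op_shift A m u) (op_shift A m u); set y := ip (op_shift A m u) u.
set U := ip u u => h1 h2 h3 h4.
have h5 : (2 * g / 16 * U) ^+ 2 <= y ^+ 2.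
  rewrite lerXn2r// nnegrE; last exact: T_ge0.
  by apply: mulr_ge0; [lra | exact: ltW].
have h6 : x * U <= (g / 16) ^+ 2 * U * U by rewrite ler_pM2r.
have h7 : 0 < (g / 16 * U) ^+ 2 by rewrite exprn_gt0// mulr_gt0// divr_gt0.
nra.
Qed.

Lemma exists_left_kernel n k (G : 'M[R]_(n, k)) : (k < n)%N ->
  exists2 c : 'rV_n, c != 0 & c *m G = 0.
Proof.
move=> kn; have /rowV0Pn[c /sub_kermxP cG c0] : kermx G != 0.
  by rewrite -mxrank_eq0 mxrank_ker -lt0n subn_gt0 (leq_ltn_trans (rank_leq_col G)).
by exists c.
Qed.

Lemma exists_orthogonal_combination n k (w : 'I_n -> V) (e : 'I_k -> V) :
  (k < n)%N -> exists2 c : 'I_n -> R, (exists i, c i != 0) &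
    forall j, ip (\sum_i c i *: w i) (e j) = 0.
Proof.
move=> kn.
have [c c0 /matrixP cG] :=
  exists_left_kernel (\matrix_(i < n, j < k) ip (w i) (e j)) kn.
exists (c 0).
  apply/existsP; move: c0; apply: contraNT; rewrite negb_exists => /forallP c0.
  by apply/eqP/rowP => i; rewrite mxE; apply/eqP; rewrite -[_ == _]negbK.
move=> j; have := cG 0 j; rewrite !mxE => <-; rewrite (bil_suml ip_sb).
by apply: eq_bigr => i _; rewrite (bilZl ip_sb) mxE.
Qed.

(** The outcome of [k] minimisation steps. The eigenvector equation is stated through [ip], hence
    modulo null vectors. *)
Definition eigen_flag k (e : nat -> V) (m : nat -> R) := forall i, (i < k)%N ->
  [/\ m i <= Lam, ip (op_shift A (m i) (e i)) (op_shift A (m i) (e i)) = 0,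
      forall j, (j < k)%N -> ip (e i) (e j) = (i == j)%:R
    & forall u, (forall j, (j < i)%N -> ip u (e j) = 0) ->
        m i * ip u u <= ip (A u) u].

Lemma eigen_ip (m : R) e u : ip (op_shift A m e) (op_shift A m e) = 0 ->
  ip (A u) e = m * ip u e.
Proof.
move=> /(@ip_null u); rewrite (bilBr ip_sb) (bilZr ip_sb) saA.2 => /eqP.
by rewrite subr_eq0 => /eqP.
Qed.

(** The orthogonal complement of the first [k < n] eigenvectors is stable and complete, and by
    counting dimensions it contains a nontrivial combination of the [w i], so that [min_eigenvector]
    applies to it. *)
Lemma exists_eigen_flag n (w : 'I_n -> V) :
  (forall c : 'I_n -> R, (exists i, c i != 0) ->
    0 < ip (\sum_i c i *: w i) (\sum_i c i *: w i) /\
    ip (A (\sum_i c i *: w i)) (\sum_i c i *: w i) <=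
      Lam * ip (\sum_i c i *: w i) (\sum_i c i *: w i)) ->
  exists e m, eigen_flag n e m.
Proof.
move=> wP; suff : forall k, (k <= n)%N -> exists e m, eigen_flag k e m.
  by apply; exact: leqnn.
elim=> [_|k IHk kn]; first by exists (fun=> 0), (fun=> 0).
have [e [m em]] := IHk (ltnW kn).
pose H : set V := [set u | forall j, (j < k)%N -> ip u (e j) = 0].
have sH : lin_subspace H.
  split=> [j _|a u v Hu Hv j jk]; first by rewrite (bil0l ip_sb).
  by rewrite ip_sb.2 Hu// Hv// mulr0 addr0.
have iH : stable_under H A.
  move=> u Hu j jk; have [_ ej _ _] := em j jk.
  by rewrite (eigen_ip _ ej) Hu// mulr0.
(* Orthogonality to [e j] passes to the limit by Cauchy-Schwarz. *)
have cH : geometric_complete H.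
  move=> v C q Hv q01 vP; have [x _ limx] := cV (fun n => I) q01 vP.
  exists x => // j jk; apply/eqP; rewrite -sqrf_eq0 eq_le sqr_ge0 andbT.
  apply/ler_addgt0Pr => d d_gt0; rewrite add0r.
  have [N /(_ N (leqnn N)) vN] := limx d d_gt0.
  have := cauchy_schwarz ip_sb (H := setT) (u := v N - x) (v := e j).
  move=> /(_ subT (fun w _ => ip_ge0 w) I I).
  have [_ _ /(_ j jk) -> _] := em j jk; rewrite eqxx mulr1.
  by rewrite (bilBl ip_sb) Hv// sub0r sqrrN => /le_trans; apply.
have [c c0 cP] := exists_orthogonal_combination w (fun j : 'I_k => e j) kn.
have [wc_gt0 wc_le] := wP c c0.
have [|mk [ek [mkLam Hek ek1 Aek mkP]]] := min_eigenvector sH iH cH.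
  exists (\sum_i c i *: w i); split=> // j jk.
  exact: (cP (Ordinal jk)).
exists (fun i => if i == k then ek else e i), (fun i => if i == k then mk else m i).
move=> i; rewrite ltnS leq_eqVlt => /predU1P[->|ik].
  rewrite eqxx; split=> // [j|u uP].
    rewrite ltnS leq_eqVlt => /predU1P[->|jk]; first by rewrite eqxx.
    by rewrite (ltn_eqF jk) Hek// gtn_eqF.
  apply: mkP => j jk; have := uP j jk; by rewrite (ltn_eqF jk).
have [miLam Aei eiP miP] := em i ik.
rewrite (ltn_eqF ik); split=> // [j|u uP].
  rewrite ltnS leq_eqVlt => /predU1P[->|jk].
    by rewrite eqxx (bilC ip_sb) Hek// (ltn_eqF ik).
  by rewrite (ltn_eqF jk) eiP.
apply: miP => j ji; have := uP j ji; by rewrite (ltn_eqF (ltn_trans ji ik)).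
Qed.

End min_max.
End semi_inner_product.

(** * Eigenvalues counted with multiplicities *)

Definition occurrences (R : eqType) (m : nat -> R) (k : nat) (s : R) : nat :=
  #|[pred i : 'I_k | m i == s]|.

(** Double counting, by exchanging the sums over values and indices. *)
Lemma sum_occurrences (R : eqType) (m : nat -> R) k (S : seq R) : uniq S ->
  (\sum_(s <- S) occurrences m k s)%N = #|[pred i : 'I_k | m i \in S]|.
Proof.
move=> uS; rewrite -sum1_card big_mkcond /=.
under eq_bigr => s _ do rewrite /occurrences -sum1_card big_mkcond /=.
rewrite exchange_big [RHS]big_mkcond /=; apply: eq_bigr => i _.
rewrite inE -[RHS]/(nat_of_bool (m i \in S)) -(count_uniq_mem _ uS) -sum1_count.
rewrite [RHS]big_mkcond /=; apply: eq_bigr => s _.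
by rewrite inE eq_sym.
Qed.

Section eigen_counting.
Context d (T : measurableType d) (R : realType) (mu : {measure set T -> \bar R}).
Local Notation V := (LfunType mu (lee1n 2)).
Variables (A : (T -> R) -> T -> R) (AV : V -> V) (ip : V -> V -> R).
Hypothesis AVE : forall u : V, (AV u : T -> R) = A u.
Hypothesis ip_sb : symmetric_bilinear ip.
Hypothesis ip_ge0 : forall u, 0 <= ip u u.
Hypothesis saA : self_adjoint ip AV.
Hypothesis ip_ae0 : forall u : V, ip u u = 0 <-> (u : T -> R) = cst 0 %[ae mu].

(** Translates almost-everywhere equalities of functions into null vectors of [ip], the language of
    the abstract results. *)
Lemma eigenspaceP s (u : V) :
  eigenspace mu A s u <-> ip (op_shift AV s u) (op_shift AV s u) = 0.
Proof.
rewrite ip_ae0; split=> [[_ Au]|Au].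
  apply: filterS Au => x /= + _ => /(_ I); rewrite -AVE => AVu.
  by apply/eqP; rewrite [X in X == _]/(AV u x - s * u x) subr_eq0 AVu.
split; first exact: LfunP.
apply: filterS Au => x /= + _ => /(_ I); rewrite -AVE.
by move=> /eqP; rewrite [X in X == _]/(AV u x - s * u x) subr_eq0 => /eqP.
Qed.

Lemma eigenspace_Lfun s (f : T -> R) : eigenspace mu A s f ->
  exists u : V, (u : T -> R) = f.
Proof. by move=> [fL _]; exists (Lfun_Sub (lee1n 2) fL). Qed.

Lemma Lfun_sumE n (c : 'I_n -> R) (w : 'I_n -> V) x :
  (\sum_i c i *: w i : V) x = \sum_i c i * w i x.
Proof. by elim/big_rec2: _ => // i y z _ <-. Qed.

Lemma is_eigenvalueP s : is_eigenvalue mu A s <->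
  exists u : V, 0 < ip u u /\ ip (op_shift AV s u) (op_shift AV s u) = 0.
Proof.
split=> [[f /[dup] fs /eigenspace_Lfun[u uf] f0]|[u [u_gt0 us]]].
  exists u; split; last by apply/eigenspaceP; rewrite uf.
  rewrite lt0r ip_ge0 andbT; apply/eqP => u0; apply: f0.
  by rewrite -uf; apply/ip_ae0.
exists u; first exact/eigenspaceP.
by move=> /ip_ae0 u0; rewrite u0 ltxx in u_gt0.
Qed.

(** * Positions of the values of a flag among the eigenvalues *)

Section flag.
Variables (Lam : R) (k : nat) (e : nat -> V) (m : nat -> R).
Hypothesis flag : eigen_flag ip AV Lam k.+1 e m.

Lemma flag_ip i j : (i <= k)%N -> (j <= k)%N -> ip (e i) (e j) = (i == j)%:R.
Proof. by move=> ik jk; have [_ _ + _] := flag ik; apply. Qed.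

Lemma flag_ipA i u : (i <= k)%N -> ip (AV u) (e i) = m i * ip u (e i).
Proof.
move=> ik; have [_ eP _ _] := flag ik.
exact: (eigen_ip ip_sb ip_ge0 saA _ eP).
Qed.

(** The vector [e k] competes in the minimisation problem that defines [m i]. *)
Lemma flag_monotone i : (i <= k)%N -> m i <= m k.
Proof.
move=> ik; have [_ _ _ miP] := flag (ik : (i < k.+1)%N).
have := miP (e k); rewrite flag_ipA// flag_ip// eqxx !mulr1; apply=> j ji.
by rewrite flag_ip// ?gtn_eqF// ?(leq_trans (ltnW ji))// (leq_trans ji).
Qed.

Lemma flag_eigenvalue i : (i <= k)%N -> is_eigenvalue mu A (m i).
Proof.
move=> ik; apply/is_eigenvalueP; exists (e i); have [_ ? _ _] := flag ik.
by rewrite flag_ip// eqxx ltr01.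
Qed.

(** The [e i] with [m i = s] are orthonormal, hence free in the eigenspace of [s]. *)
Lemma occurrences_le_multiplicity s :
  ((occurrences m k.+1 s)%:R%:E <= multiplicity mu A s)%E.
Proof.
apply: ereal_sup_ubound; exists (occurrences m k.+1 s) => //.
pose f (j : 'I_(occurrences m k.+1 s)) : 'I_k.+1 := enum_val j.
have fk j : (f j <= k)%N by rewrite -ltnS.
exists (fun j => e (f j)) => [j|c cP j].
  apply/eigenspaceP; have := enum_valP j; rewrite inE => /eqP <-.
  by have [_ ? _ _] := flag (fk j).
pose U : V := \sum_i c i *: e (f i).
have U0 : ip U U = 0.
  by apply/ip_ae0; apply: filterS cP => x /= + _ => /(_ I) <-; rewrite Lfun_sumE.
have : ip (e (f j)) U = 0 by exact: ip_null.
rewrite (bilC ip_sb) (bil_suml ip_sb) (bigD1 j)//= big1 => [|i ij].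
  by rewrite (bilZl ip_sb) flag_ip// eqxx mulr1 addr0.
rewrite (bilZl ip_sb) flag_ip//; case: eqP => [/ord_inj/enum_val_inj ji|].
  by rewrite ji eqxx in ij.
by rewrite mulr0.
Qed.

(* An eigenvector for [s < m k] orthogonal to the [e i] with [m i = s] is
   orthogonal to all the [e i], [i < k], contradicting the minimality of [m k]. *)
Lemma multiplicity_le_occurrences s : s < m k ->
  (multiplicity mu A s <= (occurrences m k s)%:R%:E)%E.
Proof.
move=> sm; apply: ge_ereal_sup => _ [n [u us u_free] <-].
rewrite lee_fin ler_nat leqNgt; apply/negP => nk.
have [w wE] : {w : 'I_n -> V & forall i, (w i : T -> R) = u i}.
  apply: (@choice _ _ (fun i (w : V) => (w : T -> R) = u i)) => i.
  exact: eigenspace_Lfun (us i).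
pose f (j : 'I_(occurrences m k s)) : 'I_k := enum_val j.
have [c [i0 ci0] cP] :=
  exists_orthogonal_combination ip_sb w (fun j => e (f j)) nk.
set U := \sum_i c i *: w i in cP.
have UA x : ip (AV U) x = s * ip U x.
  rewrite saA.2 !(bil_suml ip_sb) mulr_sumr; apply: eq_bigr => i _.
  rewrite !(bilZl ip_sb) mulrCA; congr (_ * _).
  rewrite ![ip (w i) _](bilC ip_sb); apply: (eigen_ip ip_sb ip_ge0 saA).
  by apply/eigenspaceP; rewrite wE.
have Ue j : (j < k)%N -> ip U (e j) = 0.
  move=> jk; have [ms|ms] := eqVneq (m j) s.
    have js : Ordinal jk \in [pred i : 'I_k | m i == s] by rewrite inE /= ms.
    have := cP (enum_rank_in js (Ordinal jk)).
    by rewrite /f enum_rankK_in.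
  (* Eigenvectors for distinct eigenvalues are orthogonal. *)
  have := flag_ipA U (ltnW jk); rewrite UA => /eqP.
  by rewrite -subr_eq0 -mulrBl mulf_eq0 subr_eq0 eq_sym (negbTE ms) => /eqP.
have U0 : ip U U = 0.
  have [_ _ _ /(_ U Ue)] := flag (leqnn k.+1).
  rewrite UA -subr_ge0 -mulrBl => sU; apply/eqP.
  by rewrite eq_le ip_ge0 andbT -(@nmulr_rge0 _ (s - m k)) ?subr_lt0.
have /u_free/(_ i0)/eqP : (fun x => \sum_(i < n) c i * u i x) = cst 0 %[ae mu].
  move/ip_ae0: U0; apply: filterS => x /= + _ => /(_ I) Ux.
  by rewrite -[RHS]Ux /U Lfun_sumE; apply: eq_bigr => i _; rewrite wE.
by rewrite (negbTE ci0).
Qed.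

(** The distinct values among [m 0], ..., [m k] suffice: their occurrences add up to [k.+1]. *)
Lemma eigenvalue_count_ge :
  (k.+1%:R%:E <= eigenvalue_count mu A [set s | (s <= m k)%R])%E.
Proof.
pose S := undup [seq m i | i <- iota 0 k.+1].
have uS : uniq S by exact: undup_uniq.
have mS i : (i < k.+1)%N -> m i \in S.
  by move=> ik; rewrite mem_undup map_f// mem_iota.
apply: esum_ge; exists [set` S].
  split; first exact: finite_seq.
  move=> s /=; rewrite mem_undup => /mapP[i]; rewrite mem_iota ltnS => ik ->.
  by split; [exact: flag_monotone | exact: flag_eigenvalue].
rewrite -fsbig_seq//=.
apply: (@le_trans _ _ (\sum_(s <- S) (occurrences m k.+1 s)%:R%:E)%E).
  rewrite sumEFin -natr_sum sum_occurrences// lee_fin ler_nat.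
  rewrite -[leqLHS]card_ord; apply/subset_leq_card/fintype.subsetP => i _.
  by rewrite inE /= mS.
by apply: lee_sum => s _; exact: occurrences_le_multiplicity.
Qed.

(** Below [m k], multiplicities are bounded by the occurrences among the first [k] values only, and
    these total at most [k] on every finite set. *)
Lemma eigenvalue_count_lt :
  (eigenvalue_count mu A [set s | (s < m k)%R] < k.+1%:R%:E)%E.
Proof.
apply: (@le_lt_trans _ _ k%:R%:E); last by rewrite lte_fin ltr_nat.
apply: ge_ereal_sup => _ [F [finF Fm] <-].
rewrite fsbig_finite//=; set S : seq R := finmap.enum_fset (fset_set F).
apply: (@le_trans _ _ (\sum_(s <- S) (occurrences m k s)%:R%:E)%E).
  rewrite big_seq [leRHS]big_seq; apply: lee_sum => s.
  rewrite (in_fset_set finF) inE => /Fm[sm _].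
  exact: multiplicity_le_occurrences.
rewrite sumEFin -natr_sum sum_occurrences ?finmap.fset_uniq// lee_fin ler_nat.
by rewrite -[leqRHS]card_ord max_card.
Qed.

(** Flags are indexed from [0] and eigenvalues from [1], so [m k] has position [k.+1]. No value in
    that position exceeds [m k]; since [m k] itself qualifies, the default [lambda_infty] is not
    taken. *)
Lemma lambda_le_flag : ((m k)%:E < lambda_infty mu A)%E ->
  (lambda_ mu A k.+1 <= (m k)%:E)%E.
Proof.
move=> mk_lt; rewrite /lambda_; case: xgetP => [_ -> [t]|].
  move=> [t_eig t_lt t_count _] <-; rewrite lee_fin leNgt; apply/negP => kt.
  have : (k.+1%:R%:E <= eigenvalue_count mu A [set s | (s < t)%R])%E.
    apply: (le_trans eigenvalue_count_ge).
    apply: ge_ereal_sup => _ [F [finF FS] <-].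
    apply: ereal_sup_ubound; exists F => //; split=> // s /FS[/= sk s_eig].
    by split=> //=; exact: le_lt_trans kt.
  by rewrite leNgt t_count.
move=> /(_ (m k)%:E) []; exists (m k) => //; split=> //.
- exact: flag_eigenvalue.
- exact: eigenvalue_count_lt.
- exact: eigenvalue_count_ge.
Qed.

End flag.

(** * Spectral gaps and the upper bound for an eigenvalue *)

Section lambda_le.
Variables (K M Lam : R).
Hypothesis A_ge0 : forall u, 0 <= ip (AV u) u.
Hypothesis A_le : forall u, ip (AV u) u <= K * ip u u.
Hypothesis cV : geometric_complete ip setT.
Local Notation norm u := (fine ('N[mu]_2%:E[EFin \o u])).
Hypothesis ip_le : forall u : V, ip u u <= M * norm u ^+ 2.
Hypothesis norm_le : forall u : V, norm u ^+ 2 <= M * ip u u.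

(** A bounded inverse of [A - c] would bound [ip u u] by a fixed multiple of [ip] at [(A - c) u],
    the two norms being equivalent. *)
Lemma approx_eigenvalue_spectrum c :
  approx_eigenvalue ip setT AV c -> spectrum mu A c.
Proof.
move=> c_approx [_ _ [C CP]].
have normP (u : V) : norm u <= `|C| * norm (op_shift AV c u).
  have := CP u (LfunP u); set v := op_shift AV c u.
  have -> : shifted A c u = v by rewrite /shifted -AVE.
  have fineN (f : V) : 'N[mu]_2%:E[EFin \o f]%E = (norm f)%:E.
    by rewrite -finite_norm_fine.
  rewrite (fineN u) (fineN v) -EFinM lee_fin => /le_trans; apply.
  by rewrite ler_wpM2r ?ler_norm// fine_ge0// Lnorm_ge0.
have norm_ge0 (u : V) : 0 <= norm u by rewrite fine_ge0// Lnorm_ge0.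
(* [M] and [C] have no known sign, hence the absolute values; the summand [1] makes [D] invertible.
   Testing at level [(2 * D)^-1] then gives [ip u u <= ip u u / 2]. *)
pose D := `|M| * `|C| ^+ 2 * `|M| + 1.
have D_gt0 : 0 < D by rewrite ltr_pwDr// !mulr_ge0// sqr_ge0.
have [|u [_ u_gt0 uP]] := c_approx (2 * D)^-1.
  by rewrite invr_gt0 mulr_gt0.
have : ip u u <= D * ip (op_shift AV c u) (op_shift AV c u).
  set v := op_shift AV c u.
  have h1 : ip u u <= `|M| * norm u ^+ 2.
    by apply: (le_trans (ip_le u)); rewrite ler_wpM2r ?sqr_ge0// ler_norm.
  have h2 : norm v ^+ 2 <= `|M| * ip v v.
    by apply: (le_trans (norm_le v)); rewrite ler_wpM2r// ler_norm.
  have h3 : norm u ^+ 2 <= `|C| ^+ 2 * norm v ^+ 2.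
    by rewrite -exprMn lerXn2r// nnegrE// mulr_ge0.
  apply: (le_trans h1).
  have -> : D * ip v v = `|M| * (`|C| ^+ 2 * (`|M| * ip v v)) + ip v v.
    by rewrite /D; ring.
  apply: (@le_trans _ _ (`|M| * (`|C| ^+ 2 * (`|M| * ip v v)))).
    rewrite ler_wpM2l//; apply: (le_trans h3).
    by rewrite ler_wpM2l// sqr_ge0.
  by rewrite lerDl.
apply/negP; rewrite -ltNge; rewrite -(ler_pM2l D_gt0) in uP.
apply: (le_lt_trans uP).
have -> : D * ((2 * D)^-1 * ip u u) = ip u u / 2.
  by field; rewrite gt_eqF.
by rewrite ltr_pdivrMr// ltr_pMr// ltr1n.
Qed.

(** In every case [lambda_] is at most [lambda_infty], which settles [lambda_infty <= Lam].
    Otherwise each approximate eigenvalue up to [Lam] is in the discrete spectrum, and its isolation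
    gives the gap needed for a flag. *)
Lemma lambda_le n (w : 'I_n -> V) : (0 < n)%N ->
  (forall c : 'I_n -> R, (exists i, c i != 0) ->
    0 < ip (\sum_i c i *: w i) (\sum_i c i *: w i) /\
    ip (AV (\sum_i c i *: w i)) (\sum_i c i *: w i) <=
      Lam * ip (\sum_i c i *: w i) (\sum_i c i *: w i)) ->
  (lambda_ mu A n <= Lam%:E)%E.
Proof.
case: n w => // n w _ wP.
have [inf_le|inf_gt] := leP (lambda_infty mu A) Lam%:E.
  rewrite /lambda_; case: xgetP => [_ -> [t [_ t_lt _ _] <-]|_] //.
  by rewrite (le_trans (ltW t_lt)).
have gapA c : c <= Lam -> approx_eigenvalue ip setT AV c ->
  exists2 g, 0 < g &
    forall c', c < c' -> c' < c + 2 * g -> ~ approx_eigenvalue ip setT AV c'.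
  move=> cLam /approx_eigenvalue_spectrum c_spec.
  have [_ c_isol _] : discrete_spectrum mu A c.
    apply: contrapT => c_disc.
    have : (lambda_infty mu A <= c%:E)%E.
      by apply: ereal_inf_lbound; exists c.
    by apply/negP; rewrite -ltNge (le_lt_trans _ inf_gt)// lee_fin.
  move: c_isol => /existsNP[U /not_implyP[/nbhs_ballP[g /= g_gt0 gU] noU]].
  (* The gap has length twice its parameter, so half the isolation radius is taken. *)
  exists (g / 2); first by rewrite divr_gt0.
  move=> c' cc' c'g /approx_eigenvalue_spectrum c'_spec; apply: noU.
  exists c'; split; [by rewrite gt_eqF | exact: c'_spec |].
  apply: gU; rewrite /ball/= ltr_distlC; apply/andP; split; lra.
have [e [m flag]] := exists_eigen_flag ip_sb ip_ge0 saA A_ge0 A_le cV gapA wP.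
have [mLam _ _ _] := flag n (leqnn n.+1).
apply: (le_trans (lambda_le_flag flag _)); last by rewrite lee_fin.
by apply: le_lt_trans inf_gt; rewrite lee_fin.
Qed.

End lambda_le.
End eigen_counting.

(** * Weighted inner products on L^2 *)

(** With [err] the tail of the geometric series, [u n - err n] increases and [u n + err n]
    decreases; the limit is the supremum of the former. *)
Lemma geometric_limit (R : realType) (u : nat -> R) (s B : R) :
  0 <= s < 1 -> (forall n, `|u n.+1 - u n| <= B * s ^+ n) ->
  exists2 l, u n @[n --> \oo] --> l &
    forall n, `|u n - l| <= B * s ^+ n / (1 - s).
Proof.
move=> /andP[s_ge0 s_lt1] us.
have s'_gt0 : 0 < 1 - s by rewrite subr_gt0.
pose err n := B * s ^+ n / (1 - s).
have errS n : err n - err n.+1 = B * s ^+ n.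
  by rewrite /err exprS; field; rewrite gt_eqF.
have B_ge0 : 0 <= B.
  by have := us 0%N; rewrite mulr1; apply: le_trans; exact: normr_ge0.
have err_ge0 n : 0 <= err n.
  by rewrite /err !mulr_ge0 ?invr_ge0 ?exprn_ge0// ltW.
have lo : {homo (fun n => u n - err n) : m n / (m <= n)%N >-> m <= n}.
  apply/nondecreasing_seqP => n; have := us n; rewrite -errS ler_norml.
  by move=> /andP[]; lra.
have up : {homo (fun n => u n + err n) : m n / (m <= n)%N >-> n <= m}.
  apply/nonincreasing_seqP => n; have := us n; rewrite -errS ler_norml.
  by move=> /andP[]; lra.
have lo_up m n : u m - err m <= u n + err n.
  have [mn|/ltnW nm] := leqP m n.
    by apply: (le_trans (lo _ _ mn)); have := err_ge0 n; lra.
  by apply: le_trans (up _ _ nm); have := err_ge0 m; lra.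
pose l := sup (range (fun n => u n - err n)).
have has_l : has_sup (range (fun n => u n - err n)).
  split; first by exists (u 0%N - err 0%N), 0%N.
  by exists (u 0%N + err 0%N) => _ [m _ <-].
have ul n : `|u n - l| <= err n.
  have : u n - err n <= l by apply: sup_upper_bound => //; exists n.
  have : l <= u n + err n.
    by apply: sup_le_ub; [case: has_l | move=> _ [m _ <-]].
  by rewrite ler_norml => *; apply/andP; split; lra.
exists l => //; apply/cvgrPdist_le => e e_gt0.
have : geometric (B / (1 - s)) s n @[n --> \oo] --> (0 : R).
  by apply: cvg_geometric; rewrite ger0_norm.
move=> /cvgrPdist_le/(_ e e_gt0); apply: filterS => n.
rewrite sub0r normrN /geometric/= => errn; rewrite distrC.
apply: (le_trans (ul n)); apply: le_trans errn; rewrite /err mulrAC.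
exact: ler_norm.
Qed.

Section L2.
Context d (T : measurableType d) (R : realType).
Variable mu : {finite_measure set T -> \bar R}.
Local Notation V := (LfunType mu (lee1n 2)).
Local Notation Rintegrable f := (mu.-integrable setT (EFin \o f)).

Lemma Lfun2P (f : T -> R) : measurable_fun setT f ->
  (\int[mu]_x (f x ^+ 2)%:E < +oo)%E -> f \in Lfun mu 2%:E.
Proof.
move=> mf f2; rewrite inE; apply/andP; split; rewrite inE//=.
rewrite /finite_norm unlock /= poweR_lty//.
by under eq_integral => x _ do rewrite powR_mulrn// real_normK ?num_real//.
Qed.

Lemma Lfun2_measurable (u : V) : measurable_fun setT u.
Proof. by have := LfunP u; rewrite inE => /andP[/[!inE]]. Qed.

Lemma Lfun2_integrable_mul (u v : V) : Rintegrable (fun x => u x * v x).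
Proof. by apply/Lfun1_integrable/Lfun2_mul_Lfun1; exact: LfunP. Qed.

Lemma Lfun2_integrable (u : V) : Rintegrable u.
Proof.
apply/Lfun1_integrable; apply: Lfun_subset12; last exact: LfunP.
exact: fin_num_measure.
Qed.

Lemma Lnorm2_sqr (u : V) :
  fine ('N[mu]_2%:E[EFin \o u]) ^+ 2 = \int[mu]_x (u x ^+ 2).
Proof.
apply: EFin_inj; rewrite -powR_mulrn ?fine_ge0 ?Lnorm_ge0// -poweR_EFin.
rewrite finite_norm_fine powR_Lnorm//.
rewrite /Rintegral fineK; last first.
  by apply: integrable_fin_num => //; exact: (Lfun2_integrable_mul u u).
apply: eq_integral => x _.
by rewrite abse_EFin poweR_EFin powR_mulrn// real_normK// num_real.
Qed.

Section weighted.
Variables (w : T -> R) (a b : R).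
Hypotheses (mw : measurable_fun setT w) (a_gt0 : 0 < a).
Hypothesis w_bounds : forall x, a <= w x <= b.

Let w_gt0 x : 0 < w x.
Proof. by have /andP[aw _] := w_bounds x; exact: lt_le_trans aw. Qed.

Definition weighted_ip (u v : V) : R := \int[mu]_x (w x * (u x * v x)).
Local Notation ip := weighted_ip.

Lemma integrable_weight (f : T -> R) :
  Rintegrable f -> Rintegrable (fun x => w x * f x).
Proof.
move=> intf; apply: (@integrableMr _ _ _ mu setT measurableT w (EFin \o f)) => //.
exists b; split; first exact: num_real.
move=> y by_ x _; have /andP[aw wb] := w_bounds x.
by rewrite /= (ger0_norm (ltW (w_gt0 x))) ltW// (le_lt_trans wb).
Qed.

Let intw (u v : V) : Rintegrable (fun x => w x * (u x * v x)).
Proof. by apply: integrable_weight; exact: Lfun2_integrable_mul. Qed.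

Lemma weighted_ip_sb : symmetric_bilinear ip.
Proof.
split=> [u v|c u v z].
  by apply: eq_Rintegral => x _; rewrite (mulrC (u x)).
rewrite /ip -RintegralZl// -RintegralD//; last first.
  exact: (integrableZl _ c (intw u z)).
by apply: eq_Rintegral => x _; rewrite -[(_ + _ : V) x]/(c * u x + v x); ring.
Qed.

Lemma weighted_ip_ge0 (u : V) : 0 <= ip u u.
Proof.
by apply: Rintegral_ge0 => x _; rewrite -expr2 mulr_ge0 ?sqr_ge0// ltW.
Qed.

Lemma weighted_ip_EFin (u : V) :
  (\int[mu]_x (w x * u x ^+ 2)%:E)%E = (ip u u)%:E.
Proof. by rewrite [RHS]fineK//; exact: integrable_fin_num (intw u u). Qed.

Lemma weighted_ip_eq0 (u : V) : ip u u = 0 <-> (u : T -> R) = cst 0 %[ae mu].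
Proof.
pose f x := (w x * (u x ^+ 2))%:E.
have mf : measurable_fun setT f.
  apply/measurable_EFinP/measurable_funM => //; apply: measurable_funX.
  exact: Lfun2_measurable.
have f0 : ip u u = 0 <-> ae_eq mu setT f (cst 0%E).
  rewrite -(ae_eq_integral_abs mu measurableT mf).
  have -> : (\int[mu]_x `|f x| = (ip u u)%:E)%E.
    rewrite -weighted_ip_EFin; apply: eq_integral => x _.
    by rewrite gee0_abs// lee_fin mulr_ge0 ?sqr_ge0// ltW.
  by split=> [->//|[]].
rewrite f0; split; apply: filterS => x /= + _ => /(_ I).
  by move=> [] /eqP; rewrite mulf_eq0 gt_eqF//= sqrf_eq0 => /eqP.
by rewrite /f => ->; rewrite expr0n mulr0.
Qed.

(** The constant [b + a^-1] serves both this comparison and its converse, since [lambda_le] takes a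
    single [M]. *)
Lemma weighted_ip_le (u : V) :
  ip u u <= (b + a^-1) * fine ('N[mu]_2%:E[EFin \o u]) ^+ 2.
Proof.
rewrite Lnorm2_sqr -RintegralZl//; last exact: (Lfun2_integrable_mul u u).
apply: le_Rintegral => //.
  exact: (integrableZl _ (b + a^-1) (Lfun2_integrable_mul u u)).
move=> x _; rewrite expr2 ler_wpM2r -?expr2 ?sqr_ge0//.
have /andP[_ wb] := w_bounds x; apply: (le_trans wb).
by rewrite lerDl invr_ge0 ltW.
Qed.

Lemma norm_le_weighted_ip (u : V) :
  fine ('N[mu]_2%:E[EFin \o u]) ^+ 2 <= (b + a^-1) * ip u u.
Proof.
rewrite Lnorm2_sqr -RintegralZl//.
apply: le_Rintegral => //; first exact: (Lfun2_integrable_mul u u).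
  exact: (integrableZl _ (b + a^-1) (intw u u)).
move=> x _; rewrite -expr2 mulrA ler_peMl ?sqr_ge0//.
have /andP[aw wb] := w_bounds x.
have : 1 <= a^-1 * w x by rewrite ler_pdivlMl// mulr1.
have : 0 <= b * w x by rewrite mulr_ge0 ?ltW// (lt_le_trans _ wb).
by rewrite mulrDl; lra.
Qed.

(* Each term of the series [G] of the weighted squares [w (v n.+1 - v n)^2 / p^n],
   which has a finite integral, is bounded by [G x]; hence [v n x] converges
   geometrically wherever [G x] is finite. *)
Lemma weighted_ip_complete : geometric_complete ip setT.
Proof.
move=> v C q _ /andP[q_ge0 q_lt1] vP.
have C_ge0 : 0 <= C.
  by have := vP 0%N; rewrite mulr1; apply: le_trans; exact: weighted_ip_ge0.
(* The ratio [p = s ^+ 2] lies strictly between [q] and [1]: division by [p ^+ n] leaves integrals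
   decaying like [t ^+ n], while the pointwise increments decay like [s ^+ n]. *)
pose s := (1 + q) / 2; pose p := s ^+ 2; pose t := q / p.
have s_gt0 : 0 < s by rewrite /s; lra.
have s_lt1 : s < 1 by rewrite /s; lra.
have s'_gt0 : 0 < 1 - s by rewrite subr_gt0.
have p_gt0 : 0 < p by rewrite exprn_gt0.
have qp : q < p.
  rewrite -subr_gt0; have -> : p - q = ((1 - q) / 2) ^+ 2 by rewrite /p /s; field.
  by rewrite exprn_gt0// divr_gt0// subr_gt0.
have t_ge0 : 0 <= t by rewrite divr_ge0// ltW.
have t_lt1 : t < 1 by rewrite ltr_pdivrMr// mul1r.
pose f n x := (w x * (v n.+1 x - v n x) ^+ 2 / p ^+ n)%:E.
have tp : t * p = q by rewrite divfK ?gt_eqF.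
have pE : s ^+ 2 = p by [].
clearbody t p s.
have pn_gt0 n : 0 < p ^+ n by rewrite exprn_gt0.
have wsqr_ge0 x y : 0 <= w x * y ^+ 2 by rewrite mulr_ge0 ?sqr_ge0// ltW.
have f_ge0 n x : (0 <= f n x)%E by rewrite lee_fin divr_ge0// ltW.
have mf n : measurable_fun setT (f n).
  apply/measurable_EFinP; apply: measurable_funM => //.
  apply: measurable_funM => //; apply: measurable_funX.
  by apply: measurable_funB; exact: Lfun2_measurable.
pose G x := (\sum_(n <oo) f n x)%E.
have G_ge0 x : (0 <= G x)%E by apply: nneseries_ge0.
have mG : measurable_fun setT G by apply: ge0_emeasurable_sum => // n x _ _.
have intf n : (\int[mu]_x f n x <= (C * t ^+ n)%:E)%E.
  have -> : (\int[mu]_x f n x =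
      (ip (v n.+1 - v n) (v n.+1 - v n) / p ^+ n)%:E)%E.
    rewrite mulrC EFinM -weighted_ip_EFin -ge0_integralZl_EFin//.
    - by apply: eq_integral => x _; rewrite -EFinM mulrC.
    - by move=> x _; rewrite lee_fin mulr_ge0 ?sqr_ge0// ltW.
    - apply/measurable_EFinP/measurable_funM => //; apply: measurable_funX.
      exact: Lfun2_measurable.
    - by rewrite invr_ge0 exprn_ge0// ltW.
  by rewrite lee_fin ler_pdivrMr ?exprn_gt0// -mulrA -exprMn tp.
pose I := C / (1 - t).
have intG : (\int[mu]_x G x <= I%:E)%E.
  rewrite integral_nneseries//; apply: lime_le.
    by apply: is_cvg_nneseries => n _ _; exact: integral_ge0.
  apply: nearW => n.
  apply: (@le_trans _ _ (\sum_(0 <= i < n) (C * t ^+ i)%:E)%E).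
    by apply: lee_sum => i _; exact: intf.
  rewrite sumEFin lee_fin.
  have -> : \sum_(0 <= i < n) C * t ^+ i = series (geometric C t) n by [].
  rewrite geometric_seriesE ?lt_eqF//= /I ler_pM2r ?invr_gt0 ?subr_gt0//.
  by rewrite ler_piMr// gerBl exprn_ge0.
(* The upper limit is measurable, and equals the limit wherever [G x] is finite. *)
pose u x := fine (limn_esup (fun n => (v n x)%:E)).
have measurable_u : measurable_fun setT u.
  apply: measurableT_comp => //; apply: measurable_fun_limn_esup => n.
  by apply/measurable_EFinP; exact: Lfun2_measurable.
(* Where [G x] is infinite the right-hand side is [+oo]; elsewhere [geometric_limit] applies to the
   sequence [v n x]. *)
have vu n x : ((w x * (v n x - u x) ^+ 2)%:E <=
    (p ^+ n / (1 - s) ^+ 2)%:E * G x)%E.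
  have c_gt0 : 0 < p ^+ n / (1 - s) ^+ 2 by rewrite divr_gt0 ?exprn_gt0.
  have [Gfin|] := boolP (G x \is a fin_num); last first.
    rewrite ge0_fin_numE// -leNgt leye_eq => /eqP ->.
    by rewrite gt0_muley ?leey// lte_fin.
  have g_ge0 : 0 <= fine (G x) by rewrite fine_ge0.
  have fG k : w x * (v k.+1 x - v k x) ^+ 2 <= fine (G x) * p ^+ k.
    rewrite -ler_pdivrMr ?exprn_gt0// -lee_fin fineK// -/(f k x).
    apply: le_trans (nneseries_lim_ge k.+1 _); last by [].
    by rewrite big_nat_recr//= leeDr// sume_ge0.
  pose B := Num.sqrt (fine (G x) / w x).
  have B2 : B ^+ 2 = fine (G x) / w x.
    by rewrite sqr_sqrtr// divr_ge0// ltW.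
  have s01 : 0 <= s < 1 by rewrite s_lt1 ltW.
  have [k|l vl vlP] := @geometric_limit R (fun n => v n x) s B s01.
    rewrite -ler_sqr ?nnegrE ?mulr_ge0 ?sqrtr_ge0 ?exprn_ge0 ?(ltW s_gt0)//.
    rewrite real_normK ?num_real// exprMn B2 exprAC pE mulrAC.
    by rewrite ler_pdivlMr// mulrC.
  have -> : u x = l.
    have vlE : (v n x)%:E @[n --> \oo] --> l%:E.
      by apply/fine_cvgP; split => //; exact: nearW.
    by rewrite /u (cvg_limn_einf_sup vlE).2.
  rewrite -(fineK Gfin) -EFinM lee_fin.
  have vl2 : (v n x - l) ^+ 2 <= (B * s ^+ n / (1 - s)) ^+ 2.
    rewrite -[leLHS]real_normK ?num_real// lerXn2r ?nnegrE ?vlP//.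
    exact: le_trans (vlP n).
  apply: (@le_trans _ _ (w x * (B * s ^+ n / (1 - s)) ^+ 2)).
    by rewrite ler_wpM2l// ltW.
  rewrite !exprMn B2 exprAC pE le_eqVlt; apply/orP; left; apply/eqP.
  by field; rewrite !gt_eqF.
have mvu n : measurable_fun setT (fun x => v n x - u x).
  by apply: measurable_funB => //; exact: Lfun2_measurable.
have mwvu n : measurable_fun setT (fun x => (w x * (v n x - u x) ^+ 2)%:E).
  by apply/measurable_EFinP/measurable_funM => //; exact: measurable_funX.
have wvu_ge0 n x : 0 <= w x * (v n x - u x) ^+ 2.
  by rewrite mulr_ge0 ?sqr_ge0// ltW.
have int_vu n : (\int[mu]_x (w x * (v n x - u x) ^+ 2)%:E <=
    (p ^+ n / (1 - s) ^+ 2 * I)%:E)%E.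
  have c_ge0 : 0 <= p ^+ n / (1 - s) ^+ 2.
    by rewrite divr_ge0 ?exprn_ge0// ltW.
  apply: (@le_trans _ _ (\int[mu]_x ((p ^+ n / (1 - s) ^+ 2)%:E * G x))%E).
    apply: ge0_le_integral => //; last exact: measurable_funeM.
    by move=> x _; rewrite lee_fin.
  rewrite ge0_integralZl_EFin// (EFinM (p ^+ n / (1 - s) ^+ 2)).
  by rewrite lee_wpmul2l// lee_fin.
(* Square-integrability is shown for [v 0 - u], using [a <= w]; the limit is then the difference of
   [v 0] and this function. *)
have v0u : (fun x => v 0%N x - u x) \in Lfun mu 2%:E.
  apply: Lfun2P => //.
  apply: (@le_lt_trans _ _ (\int[mu]_x (a^-1%:E *
      (w x * (v 0%N x - u x) ^+ 2)%:E))%E).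
    apply: ge0_le_integral => //.
    - by move=> x _; rewrite lee_fin sqr_ge0.
    - by apply/measurable_EFinP; exact: measurable_funX.
    - exact: measurable_funeM.
    - move=> x _; rewrite -EFinM lee_fin mulrA ler_peMl ?sqr_ge0//.
      by rewrite ler_pdivlMl// mulr1; case/andP: (w_bounds x).
  rewrite ge0_integralZl_EFin// ?invr_ge0 ?(ltW a_gt0)//; last first.
    by move=> x _; rewrite lee_fin.
  apply: (@le_lt_trans _ _ (a^-1%:E * (p ^+ 0 / (1 - s) ^+ 2 * I)%:E)%E).
    by apply: lee_wpmul2l; rewrite ?lee_fin ?invr_ge0 ?(ltW a_gt0).
  by rewrite -EFinM ltry.
pose U : V := v 0%N - Lfun_Sub (lee1n 2) v0u.
have UE x : U x = u x.
  by transitivity (v 0%N x - (v 0%N x - u x)); [by [] | ring].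
exists U => // e e_gt0.
have : geometric (I / (1 - s) ^+ 2) p n @[n --> \oo] --> (0 : R).
  apply: cvg_geometric; rewrite ger0_norm ?(ltW p_gt0)//.
  by rewrite -pE expr_lt1// ltW.
move=> /cvgrPdist_le/(_ e e_gt0)[N _ NP]; exists N => n /NP.
rewrite sub0r normrN /geometric/= => /(le_trans (ler_norm _)).
apply: le_trans; rewrite -lee_fin -weighted_ip_EFin.
have -> : I / (1 - s) ^+ 2 * p ^+ n = p ^+ n / (1 - s) ^+ 2 * I by ring.
apply: le_trans (int_vu n); rewrite le_eqVlt; apply/orP; left; apply/eqP.
by apply: eq_integral => x _; rewrite -UE.
Qed.

End weighted.
End L2.

(** * Laplacian of a symmetric neighbourhood relation *)

Section neighbourhood_laplacian.
Context d (T : measurableType d) (R : realType).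
Variable mu : {finite_measure set T -> \bar R}.
Local Notation V := (LfunType mu (lee1n 2)).
Local Notation Rintegrable f := (mu.-integrable setT (EFin \o f)).
Local Notation mu2 := (mu \x mu)%E.
Local Notation Rintegrable2 f := (mu2.-integrable setT (EFin \o f)).

Variables (N : T -> set T) (rho a : R).
Let E : set (T * T) := [set z | N z.1 z.2].
Hypotheses (mE : measurable E) (N_sym : forall x y, N x y -> N y x).
Hypotheses (rho_gt0 : 0 < rho) (a_gt0 : 0 < a).
Hypothesis N_ge : forall x, (a%:E <= mu (N x))%E.

Let w x := fine (mu (N x)).
Let b := fine (mu setT).
Local Notation ip := (weighted_ip w).

Lemma nbh_xsection x : xsection E x = N x.
Proof. by apply/seteqP; split=> y; rewrite /xsection /= inE. Qed.

Lemma nbh_measurable x : measurable (N x).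
Proof. by rewrite -nbh_xsection; exact: measurable_xsection. Qed.

Lemma nbh_weight_bounds x : a <= w x <= b.
Proof.
have Nfin : mu (N x) \is a fin_num.
  by apply: fin_num_measure; exact: nbh_measurable.
apply/andP; split; rewrite -lee_fin ?[(b)%:E]fineK ?[(w x)%:E]fineK ?N_ge//.
  by apply: le_measure; rewrite ?inE//; exact: nbh_measurable.
exact: fin_num_measure.
Qed.

Lemma nbh_weight_measurable : measurable_fun setT w.
Proof.
apply: measurableT_comp => //.
have := measurable_fun_xsection mu mE; congr (measurable_fun _ _).
by apply/funext => x /=; rewrite nbh_xsection.
Qed.

Let w_gt0 x : 0 < w x.
Proof. by have /andP[aw _] := nbh_weight_bounds x; exact: lt_le_trans aw. Qed.

Definition nbh_laplacian (u : T -> R) (x : T) : R :=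
  (rho ^+ 2 * w x)^-1 * \int[mu]_(y in N x) (u x - u y).

Lemma Rintegrable2_tensor (f g : T -> R) : Rintegrable f -> Rintegrable g ->
  Rintegrable2 (fun z => f z.1 * g z.2).
Proof.
move=> intf intg.
have mf : measurable_fun setT f by exact/measurable_EFinP/(measurable_int mu).
have mg : measurable_fun setT g by exact/measurable_EFinP/(measurable_int mu).
apply/integrable12ltyP.
  apply/measurable_EFinP/measurable_funM.
    exact: (measurableT_comp mf (@measurable_fst _ _ _ _)).
  exact: (measurableT_comp mg (@measurable_snd _ _ _ _)).
have -> : (\int[mu]_x \int[mu]_y `|(EFin \o (fun z => (f z.1 * g z.2)%R)) (x, y)| =
    \int[mu]_x (`|(f x)%:E| * \int[mu]_y `|(g y)%:E|))%E.
  apply: eq_integral => x _; rewrite -ge0_integralZl//.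
    by apply: eq_integral => y _ /=; rewrite normrM.
  by apply: measurableT_comp => //; exact/measurable_EFinP.
rewrite ge0_integralZr ?integral_ge0//; last first.
  by apply: measurableT_comp => //; exact/measurable_EFinP.
move/integrableP : intf => [_ intf]; move/integrableP : intg => [_ intg].
by rewrite lte_mul_pinfty ?integral_ge0// ge0_fin_numE ?integral_ge0.
Qed.

Lemma Rintegrable2_indic (f : T * T -> R) : Rintegrable2 f ->
  Rintegrable2 (fun z => \1_E z * f z).
Proof.
move=> intf; apply: (@integrableMr _ _ _ mu2 setT measurableT \1_E (EFin \o f)) => //.
exists 1; split; first exact: num_real.
move=> y y_gt1 z _; rewrite /= indicE.
by case: (z \in E); rewrite ?normr1 ?normr0 ltW// (lt_trans ltr01).
Qed.

Lemma Rintegral2_fubini (f : T * T -> R) : Rintegrable2 f ->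
  (forall x, Rintegrable (fun y => f (x, y))) ->
  \int[mu2]_z f z = \int[mu]_x \int[mu]_y f (x, y).
Proof.
move=> intf intfx; rewrite /Rintegral -integral12_prod_meas1//; congr fine.
apply: eq_integral => x _; rewrite fineK//.
exact: integrable_fin_num (intfx x).
Qed.

Lemma Rintegral2_swap (f : T * T -> R) : Rintegrable2 f ->
  Rintegrable2 (fun z => f (z.2, z.1)) ->
  \int[mu2]_z f z = \int[mu2]_z f (z.2, z.1).
Proof.
move=> intf intf'; rewrite /Rintegral -integral12_prod_meas1// -integral21_prod_meas1//.
Qed.

Lemma Rintegral_nbh (f : T -> R) x :
  \int[mu]_y (\1_E (x, y) * f y) = \int[mu]_(y in N x) f y.
Proof.
rewrite [RHS]Rintegral_mkcond; apply: eq_Rintegral => y _.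
rewrite indicE patchE; have [Nxy|Nxy] := pselect (N x y).
  by rewrite !mem_set ?mul1r.
by rewrite !memNset ?mul0r.
Qed.

Lemma integrable_nbh (f : T -> R) x : Rintegrable f ->
  Rintegrable (fun y => \1_E (x, y) * f y).
Proof.
move=> intf; have -> : (fun y => \1_E (x, y) * f y) = (fun y => \1_(N x) y * f y).
  apply/funext => y; rewrite !indicE; have [Nxy|Nxy] := pselect (N x y).
    by rewrite !mem_set.
  by rewrite !memNset.
have mN := nbh_measurable x.
apply: (@integrableMr _ _ _ mu setT measurableT \1_(N x) (EFin \o f)) => //.
exists 1; split; first exact: num_real.
move=> y y_gt1 z _; rewrite /= indicE.
by case: (z \in N x); rewrite ?normr1 ?normr0 ltW// (lt_trans ltr01).
Qed.

Lemma Rintegrable_nbh (f : T -> R) x : Rintegrable f ->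
  mu.-integrable (N x) (EFin \o f).
Proof. by apply: integrableS => //; exact: nbh_measurable. Qed.

Lemma Rintegrable_cst (c : R) : Rintegrable (fun _ : T => c).
Proof. exact: finite_measure_integrable_cst. Qed.

Definition nbh_integral (u : T -> R) (x : T) : R := \int[mu]_(y in N x) u y.

(** This is an inner integral of an integrable function on the product, so Fubini gives
    measurability. *)
Lemma nbh_integral_measurable (u : T -> R) : Rintegrable u ->
  measurable_fun setT (nbh_integral u).
Proof.
move=> intu; have intE : Rintegrable2 (fun z => \1_E z * (1 * u z.2)).
  exact/Rintegrable2_indic/(Rintegrable2_tensor (Rintegrable_cst 1)).
have := measurable_fubini_F intE; rewrite /fubini_F => mF.
have -> : nbh_integral u =
    fine \o (fun x => \int[mu]_y (EFin \o (fun z => \1_E z * (1 * u z.2)))%R (x, y))%E.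
  apply/funext => x; rewrite /nbh_integral -Rintegral_nbh.
  by congr fine; apply: eq_integral => y _ /=; rewrite mul1r.
exact: measurableT_comp.
Qed.

Lemma nbh_integral_le (u : T -> R) x : Rintegrable u ->
  `|nbh_integral u x| <= \int[mu]_y `|u y|.
Proof.
move=> intu; have mN := nbh_measurable x.
apply: (le_trans (le_normr_Rintegral mN (Rintegrable_nbh x intu))).
rewrite -Rintegral_nbh; have intu' := integrable_norm intu.
apply: le_Rintegral => //; first exact: integrable_nbh.
move=> y _; rewrite indicE; case: (_ \in _); rewrite ?mul1r// mul0r.
exact: normr_ge0.
Qed.

Lemma nbh_laplacianE (u : T -> R) x : Rintegrable u ->
  nbh_laplacian u x =
    rho ^- 2 * u x - (rho ^+ 2 * w x)^-1 * nbh_integral u x.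
Proof.
move=> intu; rewrite /nbh_laplacian RintegralB ?Rintegral_cst//; first last.
- exact: Rintegrable_nbh.
- exact/Rintegrable_nbh/Rintegrable_cst.
- exact: nbh_measurable.
- exact: nbh_measurable.
by rewrite -/(w x) -/(nbh_integral u x); field; rewrite !gt_eqF.
Qed.

Lemma Lfun2_bounded (f : T -> R) (c : R) : measurable_fun setT f ->
  (forall x, `|f x| <= c) -> f \in Lfun mu 2%:E.
Proof.
move=> mf fc; apply: Lfun2P => //.
apply: (@le_lt_trans _ _ (\int[mu]_x (c ^+ 2)%:E)%E).
  apply: ge0_le_integral => //.
  - by move=> x _; rewrite lee_fin sqr_ge0.
  - by apply/measurable_EFinP; exact: measurable_funX.
  - move=> x _; rewrite lee_fin -[leLHS]real_normK ?num_real//.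
    by rewrite lerXn2r// nnegrE// (le_trans _ (fc x)).
by rewrite integral_cst// lte_mul_pinfty// ?lee_fin ?sqr_ge0// ltey_eq fin_num_measure.
Qed.

(** The measure is finite, so [u] is in [L^1]; with [w >= a] its averages are bounded, hence in
    [L^2]. *)
Lemma averaging_Lfun (u : V) :
  (fun x => (rho ^+ 2 * w x)^-1 * nbh_integral u x) \in Lfun mu 2%:E.
Proof.
have intu := Lfun2_integrable u; have rho_ge0 := ltW rho_gt0.
apply: (@Lfun2_bounded _ ((rho ^+ 2 * a)^-1 * \int[mu]_y `|u y|)).
  apply: measurable_funM; last exact: nbh_integral_measurable.
  have -> : (fun x => (rho ^+ 2 * w x)^-1) = (fun x => (rho ^+ 2 * w x) `^ (-1)).
    by apply/funext => x; rewrite powR_inv1// mulr_ge0 ?sqr_ge0// ltW.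
  apply: (measurableT_comp (measurable_powR (-1))).
  by apply: measurable_funM => //; exact: nbh_weight_measurable.
move=> x; rewrite normrM; apply: ler_pM => //; last exact: nbh_integral_le.
rewrite ger0_norm ?invr_ge0 ?mulr_ge0 ?sqr_ge0 ?(ltW (w_gt0 x))//.
rewrite lef_pV2 ?posrE ?mulr_gt0 ?exprn_gt0// ler_pM2l ?exprn_gt0//.
by case/andP: (nbh_weight_bounds x).
Qed.

Definition nbh_operator (u : V) : V :=
  rho ^- 2 *: u - Lfun_Sub (lee1n 2) (averaging_Lfun u).

Lemma nbh_operatorE (u : V) : (nbh_operator u : T -> R) = nbh_laplacian u.
Proof.
by apply/funext => x; rewrite nbh_laplacianE//; exact: Lfun2_integrable.
Qed.

Lemma nbh_operator_linear : linear nbh_operator.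
Proof.
move=> c u v; apply/LfuneqP => x.
transitivity (c * nbh_operator u x + nbh_operator v x); last by [].
have [intu intv intcuv] := And3 (Lfun2_integrable u) (Lfun2_integrable v)
  (Lfun2_integrable (c *: u + v)).
rewrite !nbh_operatorE !nbh_laplacianE//.
have -> : nbh_integral (c *: u + v : V) x =
    c * nbh_integral u x + nbh_integral v x.
  have mN := nbh_measurable x.
  rewrite /nbh_integral -RintegralZl ?Rintegrable_nbh// -RintegralD//.
    exact: (integrableZl mN c (Rintegrable_nbh x intu)).
  exact: Rintegrable_nbh.
have -> : (c *: u + v : V) x = c * u x + v x by [].
ring.
Qed.

(** The Dirichlet form of the relation, over ordered pairs; this is the source of the factor 2 in
    [nbh_operator_energy]. *)
Definition energy (u v : V) : R :=
  \int[mu2]_z (\1_E z * ((u z.1 - u z.2) * (v z.1 - v z.2))).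

Lemma Rintegrable2_eq (f g : T * T -> R) : (forall z, f z = g z) ->
  Rintegrable2 f -> Rintegrable2 g.
Proof. by move=> fg; rewrite (_ : f = g)//; exact/funext. Qed.

Lemma Rintegrable2_fst (f : T -> R) : Rintegrable f ->
  Rintegrable2 (fun z => f z.1).
Proof.
move=> intf; have := Rintegrable2_tensor intf (Rintegrable_cst 1).
by apply: Rintegrable2_eq => z; rewrite mulr1.
Qed.

Lemma Rintegrable2_snd (f : T -> R) : Rintegrable f ->
  Rintegrable2 (fun z => f z.2).
Proof.
move=> intf; have := Rintegrable2_tensor (Rintegrable_cst 1) intf.
by apply: Rintegrable2_eq => z; rewrite mul1r.
Qed.

Lemma Rintegrable2D (f g : T * T -> R) : Rintegrable2 f -> Rintegrable2 g ->
  Rintegrable2 (fun z => f z + g z).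
Proof. by move=> intf intg; exact: (integrableD measurableT intf intg). Qed.

Lemma Rintegrable2B (f g : T * T -> R) : Rintegrable2 f -> Rintegrable2 g ->
  Rintegrable2 (fun z => f z - g z).
Proof. by move=> intf intg; exact: (integrableB measurableT intf intg). Qed.

Lemma indic_nbhC x y : \1_E (x, y) = \1_E (y, x) :> R.
Proof.
rewrite !indicE; have [Nxy|Nxy] := pselect (N x y).
  by rewrite !mem_set//; exact: N_sym.
by rewrite !memNset// => /N_sym.
Qed.

Lemma Rintegral2_nbh_fst (f : T -> R) : Rintegrable f ->
  \int[mu2]_z (\1_E z * f z.1) = \int[mu]_x (w x * f x).
Proof.
move=> intf; rewrite Rintegral2_fubini.
- apply: eq_Rintegral => x _; rewrite (Rintegral_nbh (fun _ => f x)).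
  by rewrite Rintegral_cst ?(mulrC (w x))//; exact: nbh_measurable.
- exact/Rintegrable2_indic/Rintegrable2_fst.
- by move=> x; apply: (@integrable_nbh (fun _ => f x)); exact: Rintegrable_cst.
Qed.

Lemma Rintegral2_nbh_snd (f : T -> R) : Rintegrable f ->
  \int[mu2]_z (\1_E z * f z.2) = \int[mu]_x (w x * f x).
Proof.
move=> intf; have int2 := Rintegrable2_indic (Rintegrable2_snd intf).
have int1 := Rintegrable2_indic (Rintegrable2_fst intf).
rewrite -Rintegral2_nbh_fst// Rintegral2_swap//.
  by apply: eq_Rintegral => -[x y] _ /=; rewrite indic_nbhC.
by apply: Rintegrable2_eq int1 => -[x y] /=; rewrite indic_nbhC.
Qed.

(** Integrating in the second variable first, the weight [w x] cancels the normalisation of the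
    average. *)
Lemma Rintegral2_half_energy (u v : V) :
  \int[mu2]_z (\1_E z * ((u z.1 - u z.2) * v z.1)) =
  rho ^+ 2 * ip (nbh_operator u) v.
Proof.
have int_half : Rintegrable2 (fun z => (u z.1 - u z.2) * v z.1).
  have := Rintegrable2B (Rintegrable2_fst (Lfun2_integrable_mul u v))
    (Rintegrable2_tensor (Lfun2_integrable v) (Lfun2_integrable u)).
  by apply: Rintegrable2_eq => z /=; ring.
have intuv x : Rintegrable (fun y => (u x - u y) * v x).
  have := integrableZr measurableT (v x) (integrableB measurableT
    (Rintegrable_cst (u x)) (Lfun2_integrable u)).
  by [].
rewrite Rintegral2_fubini; first last.
- move=> x; exact: (@integrable_nbh (fun y => (u x - u y) * v x)).
- exact: Rintegrable2_indic.
rewrite -RintegralZl//; last first.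
  apply: integrable_weight nbh_weight_measurable a_gt0 nbh_weight_bounds _ _.
  exact: Lfun2_integrable_mul.
apply: eq_Rintegral => x _.
rewrite (Rintegral_nbh (fun y => (u x - u y) * v x)) RintegralZr; first last.
- apply: Rintegrable_nbh.
  exact: (integrableB measurableT (Rintegrable_cst (u x)) (Lfun2_integrable u)).
- exact: nbh_measurable.
rewrite nbh_operatorE /nbh_laplacian; field.
by rewrite !gt_eqF.
Qed.

(** Symmetry of [N] gives the half energy and its copy with the variables exchanged the same
    integral, and their integrands add up to that of [energy]. *)
Lemma nbh_operator_energy (u v : V) :
  2 * rho ^+ 2 * ip (nbh_operator u) v = energy u v.
Proof.
have int_half : Rintegrable2 (fun z => \1_E z * ((u z.1 - u z.2) * v z.1)).
  have := Rintegrable2B (Rintegrable2_fst (Lfun2_integrable_mul u v))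
    (Rintegrable2_tensor (Lfun2_integrable v) (Lfun2_integrable u)).
  move=> intuv; apply: Rintegrable2_indic.
  by apply: Rintegrable2_eq intuv => z /=; ring.
have int_half' : Rintegrable2 (fun z => \1_E z * ((u z.2 - u z.1) * v z.2)).
  have := Rintegrable2B (Rintegrable2_snd (Lfun2_integrable_mul u v))
    (Rintegrable2_tensor (Lfun2_integrable u) (Lfun2_integrable v)).
  move=> intuv; apply: Rintegrable2_indic.
  by apply: Rintegrable2_eq intuv => z /=; ring.
have swap : \int[mu2]_z (\1_E z * ((u z.1 - u z.2) * v z.1)) =
    \int[mu2]_z (\1_E z * ((u z.2 - u z.1) * v z.2)).
  rewrite Rintegral2_swap//.
    by apply: eq_Rintegral => -[x y] _ /=; rewrite indic_nbhC.
  by apply: Rintegrable2_eq int_half' => -[x y] /=; rewrite indic_nbhC.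
transitivity (\int[mu2]_z (\1_E z * ((u z.1 - u z.2) * v z.1)) +
              \int[mu2]_z (\1_E z * ((u z.2 - u z.1) * v z.2))).
  by rewrite -swap Rintegral2_half_energy; ring.
rewrite -RintegralD//; apply: eq_Rintegral => z _; ring.
Qed.

Lemma nbh_operator_sa : self_adjoint ip nbh_operator.
Proof.
split=> [|u v]; first exact: nbh_operator_linear.
have c0 : 2 * rho ^+ 2 != 0 by rewrite gt_eqF// mulr_gt0// exprn_gt0.
apply: (mulfI c0); rewrite nbh_operator_energy.
have ip_sb :=
  weighted_ip_sb mu nbh_weight_measurable a_gt0 nbh_weight_bounds.
rewrite (bilC ip_sb u) nbh_operator_energy.
by apply: eq_Rintegral => z _; rewrite [X in _ * X]mulrC.
Qed.

Lemma energy_ge0 (u : V) : 0 <= energy u u.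
Proof.
by apply: Rintegral_ge0 => z _; rewrite -expr2 mulr_ge0 ?sqr_ge0//.
Qed.

(** By symmetry of [N], the terms [f x] and [f y] contribute equally. *)
Lemma energy_le (u : V) (f : T -> R) : Rintegrable f ->
  (forall x y, N x y -> (u x - u y) ^+ 2 <= f x + f y) ->
  energy u u <= 2 * \int[mu]_x (w x * f x).
Proof.
move=> intf uf; rewrite mulr_natl mulr2n.
rewrite -{1}Rintegral2_nbh_fst// -Rintegral2_nbh_snd//.
have int1 := Rintegrable2_indic (Rintegrable2_fst intf).
have int2 := Rintegrable2_indic (Rintegrable2_snd intf).
rewrite -RintegralD//; apply: le_Rintegral => //.
- apply: Rintegrable2_indic.
  have := Rintegrable2D (Rintegrable2B
    (Rintegrable2_fst (Lfun2_integrable_mul u u))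
    (Rintegrable2_tensor (Lfun2_integrable u) (Lfun2_integrable u)))
    (Rintegrable2B (Rintegrable2_snd (Lfun2_integrable_mul u u))
    (Rintegrable2_tensor (Lfun2_integrable u) (Lfun2_integrable u))).
  by apply: Rintegrable2_eq => z; ring.
- exact: Rintegrable2D.
- move=> [x y] _ /=; rewrite -mulrDr -expr2 indicE.
  have [Nxy|Nxy] := pselect (N x y); last by rewrite memNset// !mul0r.
  by rewrite mem_set// !mul1r uf.
Qed.

Lemma nbh_operator_ge0 (u : V) : 0 <= ip (nbh_operator u) u.
Proof.
rewrite -(@pmulr_rge0 _ (2 * rho ^+ 2)) ?nbh_operator_energy ?energy_ge0//.
by rewrite mulr_gt0// exprn_gt0.
Qed.

Lemma nbh_operator_le (u : V) :
  ip (nbh_operator u) u <= 2 * rho ^- 2 * ip u u.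
Proof.
have c_gt0 : 0 < 2 * rho ^+ 2 by rewrite mulr_gt0// exprn_gt0.
rewrite -(ler_pM2l c_gt0) nbh_operator_energy.
(* [(p - q)^2 <= 2 p^2 + 2 q^2] suggests this choice of [f]. *)
have := @energy_le u (fun x => 2 * (u x * u x))
  (integrableZl measurableT 2 (Lfun2_integrable_mul u u)).
have -> : 2 * rho ^+ 2 * (2 * rho ^- 2 * ip u u) =
    2 * \int[mu]_x (w x * (2 * (u x * u x))).
  have -> : \int[mu]_x (w x * (2 * (u x * u x))) = 2 * ip u u.
    rewrite -RintegralZl//; first by apply: eq_Rintegral => x _; ring.
    apply: integrable_weight nbh_weight_measurable a_gt0 nbh_weight_bounds _ _.
    exact: Lfun2_integrable_mul.
  by field; rewrite gt_eqF.
by apply=> x y _; have := sqr_ge0 (u x + u y); lra.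
Qed.

End neighbourhood_laplacian.

(** * Compact metric spaces *)

Section compact_metric.
Context (R : realType) (X : pmetricType R).
Implicit Types (x y z : X) (e : R).

Lemma ball_mdistE x e y : ball x e y = (mdist x y < e) :> Prop.
Proof. by rewrite ballEmdist. Qed.

Lemma metric_ball_open x e : open (ball x e).
Proof.
rewrite openE => y; rewrite ball_mdistE => xy; apply/nbhs_ballP.
exists (e - mdist x y) => /=; first by rewrite subr_gt0.
move=> z; rewrite !ball_mdistE => yz.
by have := metric_triangle x y z; lra.
Qed.

Lemma measurable_metric_ball x e : measurable (ball x e : set (borel X)).
Proof. by apply: sub_sigma_algebra; exact: metric_ball_open. Qed.

Lemma measurable_mdist x : measurable_fun setT (mdist x : borel X -> R).
Proof.
move=> mD; apply: (measurability _ (RGenInftyO.measurableE R)) => //.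
move=> _ [_ [t ->] <-]; rewrite setTI.
have -> : (mdist x : borel X -> R) @^-1` `]-oo, t[ = ball x t.
  by apply/seteqP; split=> y /=; rewrite ball_mdistE in_itv.
exact: measurable_metric_ball.
Qed.

Hypothesis X_compact : compact [set: X].

Lemma finite_net e : 0 < e ->
  exists s : seq X, forall x, exists2 z, z \in s & ball z e x.
Proof.
move=> e_gt0; move: X_compact; rewrite compact_cover.
move=> /(_ X setT (fun z => ball z e)) [].
- by move=> z _; exact: metric_ball_open.
- by move=> z _; exists z => //; exact: ballxx.
- move=> D _ DX; exists (finmap.enum_fset D) => x.
  by have [z zD xz] := DX x I; exists z.
Qed.

(** Sending each point to a point of an [e / 2]-net within distance [e / 2] is injective on an
    [e]-separated set. *)
Lemma separated_size_bounded e : 0 < e ->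
  exists M, forall n (Y : set X), separated_set e Y -> (Y #= `I_n)%card ->
    (n <= M)%N.
Proof.
move=> e_gt0; have [s sP] := finite_net (divr_gt0 e_gt0 (ltr0Sn R 1)).
exists (size s) => n Y sepY; rewrite card_eq_sym => /pcard_eqP[f].
have fY (i : 'I_n) : Y (f i) by apply: funS => /=.
have /choice[g gP] : forall i : 'I_n, exists z : X, z \in s /\ ball z (e / 2) (f i).
  by move=> i; have [z ? ?] := sP (f i); exists z.
have gs i : (index (g i) s < size s)%N by rewrite index_mem; case: (gP i).
pose h i := Ordinal (gs i).
have h_inj : injective h.
  move=> i j /(congr1 val) /= hij.
  have gij : g i = g j.
    by rewrite -(nth_index (g i) (gP i).1) hij nth_index//; case: (gP j).
  have [_] := gP i; have [_] := gP j; rewrite -gij !ball_mdistE => gj gi.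
  apply/val_inj; apply: ('inj_f); rewrite ?inE//=.
  apply: contrapT => fij; have := sepY _ _ (fY i) (fY j) fij.
  have := metric_triangle (f i) (g i) (f j); rewrite (metric_sym (f i) (g i)).
  lra.
by have := leq_card h h_inj; rewrite !card_ord.
Qed.

(** Boundedness makes the supremum an attained maximum rather than a default value; a singleton
    shows that it is positive. *)
Lemma packing_numberP e : 0 < e ->
  (0 < packing_number X e)%N /\
  exists f : nat -> X, forall i j, (i < packing_number X e)%N ->
    (j < packing_number X e)%N -> i != j -> e <= mdist (f i) (f j).
Proof.
move=> e_gt0; have [M MP] := separated_size_bounded e_gt0.
pose S : set nat :=
  [set n | exists2 Y : set X, separated_set e Y & (Y #= `I_n)%card].
have S1 : S 1%N.
  by exists [set point]; [move=> y1 y2 -> -> | exact: card_set1].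
have [m Sm mS] : exists2 m, S m & forall n, S n -> (n <= m)%N.
  have exS : exists n, `[< S n >] by exists 1%N; apply/asboolP.
  have SM n : `[< S n >] -> (n <= M)%N by move=> /asboolP[Y sY Yn]; exact: MP sY Yn.
  case: (ex_maxnP exS SM) => m /asboolP Sm mS; exists m => // n Sn.
  by apply: mS; apply/asboolP.
have supm : supremums S m by split=> // n; exact.
have -> : packing_number X e = m.
  rewrite /packing_number -/S /supremum; case: ifPn => [/eqP S0|_].
    by rewrite S0 in S1.
  case: xgetP => [k _ kS|/(_ m)//]; exact: is_subset1_supremums kS supm.
split; first by have := mS _ S1.
have [Y sepY] := Sm; rewrite card_eq_sym => /pcard_eqP[f].
exists f => i j im jm ij; apply: sepY.
- by apply: funS.
- by apply: funS.
- move=> /('inj_f); rewrite !inE => /(_ im jm) /eqP.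
  by rewrite (negbTE ij).
Qed.

(** Measurability is for the product of the Borel sigma-algebras, so the set is written as a
    countable union of rectangles built on finite nets. *)
Lemma measurable_near_diagonal rho :
  measurable [set z : borel X * borel X | ball (z.1 : X) rho z.2].
Proof.
have e_gt0 n : 0 < n.+1%:R^-1 :> R by rewrite invr_gt0.
have /choice[s sP] : forall n, exists s : seq X,
    forall x, exists2 z, z \in s & ball z n.+1%:R^-1 x.
  by move=> n; exact: finite_net.
have -> : [set z : borel X * borel X | ball (z.1 : X) rho z.2] =
    \bigcup_n \bigcup_(z in [set` s n])
      ((ball z n.+1%:R^-1 : set (borel X)) `*`
       (ball z (rho - n.+1%:R^-1) : set (borel X))).
  apply/seteqP; split=> [[x y]|[x y] [n _ [z _ []]]] /=.
    rewrite ball_mdistE => xy.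
    (* The mesh is taken below half the slack: it is lost once in the triangle inequality and once
       in the radius of the second factor. *)
    have xy' : 0 < (rho - mdist x y) / 2 by rewrite divr_gt0// subr_gt0.
    have [n _ nP] := near_infty_natSinv_lt (PosNum xy').
    have {}nP : n.+1%:R^-1 < (rho - mdist x y) / 2 by exact: nP (leqnn n).
    have [z zs zx] := sP n x; exists n => //; exists z => //; split=> //=.
    move: zx; rewrite !ball_mdistE => zx.
    have := metric_triangle z x y; move: (n.+1%:R^-1) nP zx => t nP zx; lra.
  rewrite !ball_mdistE /= => zx zy.
  have := metric_triangle x z y; rewrite (metric_sym x z).
  by move: (n.+1%:R^-1) zx zy => t zx zy; lra.
apply: bigcupT_measurable => n; apply: fin_bigcup_measurable => // z _.
by apply: measurableX; exact: measurable_metric_ball.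
Qed.

(** Every ball of radius [rho] contains one of the finitely many balls of radius [rho / 2] around a
    net, all of positive measure. *)
Lemma ball_measure_lower_bound (mu : {finite_measure set (borel X) -> \bar R}) rho :
  full_support mu -> 0 < rho ->
  exists2 a, 0 < a & forall x, (a%:E <= mu (ball x rho))%E.
Proof.
move=> mu_full rho_gt0.
have [s sP] := finite_net (divr_gt0 rho_gt0 (ltr0Sn R 1)).
have [a a_gt0 aP] : exists2 a : R, 0 < a &
    forall z, z \in s -> (a%:E <= mu (ball z (rho / 2)))%E.
  elim: (s) => [|z t [a a_gt0 IH]]; first by exists 1.
  have z_gt0 : (0 < mu (ball z (rho / 2)))%E.
    apply: mu_full; first exact: metric_ball_open.
    by exists z; apply: ballxx; rewrite divr_gt0.
  have z_fin : mu (ball z (rho / 2)) \is a fin_num.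
    by apply: fin_num_measure; exact: measurable_metric_ball.
  exists (Num.min a (fine (mu (ball z (rho / 2))))).
    by rewrite lt_min a_gt0 fine_gt0// z_gt0 ltey_eq z_fin.
  move=> y; rewrite inE => /predU1P[->|yt].
    by rewrite -[leRHS]fineK// lee_fin ge_min lexx orbT.
  by apply: le_trans (IH y yt); rewrite lee_fin ge_min lexx.
exists a => // x; have [z zs zx] := sP x; apply: (le_trans (aP z zs)).
apply: le_measure; rewrite ?inE; [exact: measurable_metric_ball.. |].
move=> y; move: zx; rewrite !ball_mdistE => zx zy.
by have := metric_triangle x z y; rewrite (metric_sym x z); lra.
Qed.

End compact_metric.

(** * Test functions *)

Section bump.
Context (R : realType) (X : pmetricType R).
Variables (r : R) (r_gt0 : 0 < r).
Implicit Types x y : X.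

Definition bump y x : R := Num.max 0 (1 - mdist y x / r).

Lemma bump_ge0 y x : 0 <= bump y x.
Proof. by rewrite le_max lexx. Qed.

Lemma bump_le1 y x : bump y x <= 1.
Proof. by rewrite ge_max ler01 gerBl divr_ge0 ?mdist_ge0// ltW. Qed.

Lemma bump_eq0 y x : r <= mdist y x -> bump y x = 0.
Proof.
by move=> yx; rewrite /bump max_l// subr_le0 ler_pdivlMr// mul1r.
Qed.

Lemma bump_ge_half y x : mdist y x < r / 2 -> 2^-1 <= bump y x.
Proof.
move=> yx; rewrite le_max; apply/orP; right.
have : mdist y x / r < 2^-1 by rewrite ltr_pdivrMr// mulrC.
by move: (mdist y x / r) => t; lra.
Qed.

Lemma bump_lipschitz y x x' : `|bump y x - bump y x'| <= mdist x x' / r.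
Proof.
rewrite /bump.
have : mdist y x / r <= mdist y x' / r + mdist x x' / r.
  rewrite -mulrDl ler_pM2r ?invr_gt0//.
  by have := metric_triangle y x' x; rewrite (metric_sym x').
have : mdist y x' / r <= mdist y x / r + mdist x x' / r.
  rewrite -mulrDl ler_pM2r ?invr_gt0//; exact: metric_triangle.
have : 0 <= mdist x x' / r by rewrite divr_ge0 ?mdist_ge0// ltW.
move: (mdist y x / r) (mdist y x' / r) (mdist x x' / r) => t t' s *.
by case: (leP 0 (1 - t)) => ?; case: (leP 0 (1 - t')) => ?;
  rewrite ler_norml; apply/andP; split; lra.
Qed.

Lemma measurable_bump y : measurable_fun setT (bump y : borel X -> R).
Proof.
apply: measurable_maxr => //; apply: measurable_funB => //.
by apply: measurable_funM => //; exact: measurable_mdist.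
Qed.

Variables (n : nat) (y : 'I_n -> X) (c : 'I_n -> R).
Hypothesis y_sep : forall i j, i != j -> 3 * r <= mdist (y i) (y j).

(** Only one index can contribute: two would give centres at distance less than
    [r + rho + r <= 3 * r]. That bump is [1 / r]-Lipschitz. *)
Lemma bump_sum_sqrB rho x x' : rho <= r -> mdist x x' < rho ->
  (\sum_i c i * (bump (y i) x - bump (y i) x')) ^+ 2 <=
  rho ^+ 2 / r ^+ 2 * \sum_i c i ^+ 2 * \1_(ball (y i) (2 * r)) x.
Proof.
move=> rho_le_r xx'.
have rho_ge0 : 0 <= rho by apply: ltW; apply: le_lt_trans xx'; exact: mdist_ge0.
have term_ge0 i : 0 <= c i ^+ 2 * \1_(ball (y i) (2 * r)) x.
  by rewrite mulr_ge0 ?sqr_ge0// indicE.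
have rhor_ge0 : 0 <= rho ^+ 2 / r ^+ 2 by rewrite divr_ge0 ?sqr_ge0.
have [[i0 i0P]|all0] :=
    pselect (exists i, bump (y i) x != 0 \/ bump (y i) x' != 0); last first.
  rewrite big1 => [|i _]; first by rewrite expr0n mulr_ge0// sumr_ge0.
  have [-> ->] : bump (y i) x = 0 /\ bump (y i) x' = 0.
    by split; apply/eqP; apply: contrapT => /negP ?; apply: all0; exists i;
      [left|right].
  by rewrite subrr mulr0.
have near i : bump (y i) x != 0 \/ bump (y i) x' != 0 ->
    mdist (y i) x < r \/ mdist (y i) x' < r.
  by case=> /eqP b0; [left|right]; rewrite ltNge; apply/negP => /bump_eq0.
rewrite (bigD1 i0)//= big1 ?addr0 => [|j ji0]; last first.
  have [-> ->] : bump (y j) x = 0 /\ bump (y j) x' = 0; last first.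
    by rewrite subrr mulr0.
  have jP : ~ (bump (y j) x != 0 \/ bump (y j) x' != 0).
    move=> /near jP; have := y_sep ji0; have := near _ i0P.
    have := metric_triangle (y j) x (y i0); have := metric_triangle (y j) x' (y i0).
    have := metric_triangle x x' (y i0); have := metric_triangle x' x (y i0).
    rewrite (metric_sym x' x) (metric_sym x (y i0)) (metric_sym x' (y i0)).
    by move=> ? ? ? ? [] ? ?; case: jP => ?; lra.
  by split; apply/eqP; apply: contrapT => /negP ?; apply: jP; [left|right].
apply: (@le_trans _ _ (rho ^+ 2 / r ^+ 2 *
    (c i0 ^+ 2 * \1_(ball (y i0) (2 * r)) x))); last first.
  by rewrite ler_wpM2l// (bigD1 i0)//= lerDl sumr_ge0.
(* Either [x] or [x'] is within [r] of [y i0], and they are less than [rho <= r] apart; hence the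
   radius [2 * r]. *)
have i0x : ball (y i0) (2 * r) x.
  rewrite ball_mdistE; have := metric_triangle (y i0) x' x.
  by rewrite (metric_sym x' x); case: (near _ i0P) => *; lra.
rewrite indicE mem_set// mulr1 exprMn mulrC ler_wpM2r ?sqr_ge0//.
rewrite -[leLHS]real_normK ?num_real// -expr_div_n lerXn2r ?nnegrE//.
  by rewrite divr_ge0// ltW.
by apply: (le_trans (bump_lipschitz _ _ _)); rewrite ler_pM2r ?invr_gt0// ltW.
Qed.

(** Within [r / 2] of one centre, the other bumps vanish and this one is at least [1 / 2], whose
    square is the constant. *)
Lemma bump_sum_sqr x :
  4^-1 * \sum_i c i ^+ 2 * \1_(ball (y i) (r / 2)) x <=
  (\sum_i c i * bump (y i) x) ^+ 2.
Proof.
have [[i0 i0x]|out] := pselect (exists i, ball (y i) (r / 2) x); last first.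
  rewrite [in leLHS]big1 ?mulr0 ?sqr_ge0// => i _.
  by rewrite indicE memNset ?mulr0// => ix; apply: out; exists i.
have {}i0x : mdist (y i0) x < r / 2 by rewrite -ball_mdistE.
have far (j : 'I_n) : j != i0 -> r <= mdist (y j) x.
  move=> /y_sep; have := metric_triangle (y j) x (y i0).
  by rewrite (metric_sym x (y i0)); move: i0x r_gt0; lra.
rewrite (bigD1 i0)//= big1 ?addr0 => [|j ji0]; last first.
  rewrite indicE memNset ?mulr0// ball_mdistE => jx.
  by have := far j ji0; move: jx r_gt0; lra.
rewrite [in leRHS](bigD1 i0)//= [in leRHS]big1 ?addr0 => [|j ji0]; last first.
  by rewrite bump_eq0 ?mulr0// far.
rewrite indicE mem_set ?ball_mdistE// mulr1 exprMn mulrC ler_wpM2l ?sqr_ge0//.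
have -> : 4^-1 = 2^-1 ^+ 2 :> R by field.
by rewrite lerXn2r ?nnegrE ?invr_ge0 ?bump_ge0// bump_ge_half.
Qed.

End bump.

Lemma Rintegral_sum d (T : measurableType d) (R : realType)
    (mu : {measure set T -> \bar R}) (I : Type) (s : seq I) (g : I -> T -> R) :
  (forall i, mu.-integrable setT (EFin \o g i)) ->
  mu.-integrable setT (EFin \o (fun x => \sum_(i <- s) g i x)) /\
  \int[mu]_x (\sum_(i <- s) g i x) = \sum_(i <- s) \int[mu]_x g i x.
Proof.
move=> intg; elim: s => [|i s [ints IHs]].
  have -> : (fun x => \sum_(i <- [::]) g i x) = cst 0.
    by apply/funext => x; rewrite big_nil.
  by split; [exact: integrable0 | rewrite big_nil Rintegral_cst// mul0r].
have -> : (fun x => \sum_(j <- i :: s) g j x) =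
    (fun x => g i x + \sum_(j <- s) g j x).
  by apply/funext => x; rewrite big_cons.
split; first exact: (integrableD measurableT (intg i) ints).
by rewrite RintegralD// big_cons IHs.
Qed.

(** * Rayleigh quotients on the span of the bumps *)

Section test_functions.
Context (R : realType) (X : pmetricType R).
Variables (mu : {finite_measure set (borel X) -> \bar R}) (rho a r : R).
Hypotheses (X_compact : compact [set: X]) (rho_gt0 : 0 < rho) (a_gt0 : 0 < a).
Hypothesis ball_ge : forall x : X, (a%:E <= mu (ball x rho))%E.
Hypothesis rho_le_r : rho <= r.
Local Notation V := (LfunType mu (lee1n 2)).

Let N (x : borel X) : set (borel X) := ball (x : X) rho.
Let w (x : borel X) : R := fine (mu (N x)).
Let mE := measurable_near_diagonal X_compact rho.
Let mw : measurable_fun setT w := nbh_weight_measurable mu mE.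
Let w_bounds := nbh_weight_bounds (N := N) mE ball_ge.
Let N_sym (x y : borel X) : N x y -> N y x.
Proof. exact: ball_sym. Qed.
Local Notation ip := (weighted_ip w).
Local Notation A := (nbh_operator (N := N) mE rho_gt0 a_gt0 ball_ge).

Let r_gt0 : 0 < r. Proof. exact: lt_le_trans rho_le_r. Qed.

(** Real-valued form of [mu_rho] without the factor [rho ^+ 2], which cancels in [Q]. *)
Definition weighted_mass (B : set (borel X)) : R := \int[mu]_x (w x * \1_B x).

Lemma integrable_weighted_indic (B : set (borel X)) : measurable B ->
  mu.-integrable setT (EFin \o (fun x => w x * \1_B x)).
Proof.
move=> mB; apply: (integrable_weight mw a_gt0 w_bounds).
by apply: integrable_indic => //; rewrite ltey_eq fin_num_measure.
Qed.

Lemma mu_rho_mass (B : set (borel X)) : measurable B ->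
  mu_rho mu rho B = (rho ^+ 2 * weighted_mass B)%:E.
Proof.
move=> mB; have intB := integrable_weighted_indic mB.
rewrite EFinM fineK; last exact: integrable_fin_num.
rewrite -integralZl// /mu_rho (integral_mkcond B).
apply: eq_integral => x _.
rewrite patchE indicE; case: (x \in B); last by rewrite mulr0 mule0.
rewrite mulr1 [(w x)%:E]fineK//; apply: fin_num_measure.
exact: measurable_metric_ball.
Qed.

Lemma weighted_mass_gt0 (x : X) e : 0 < e -> full_support mu ->
  0 < weighted_mass (ball x e).
Proof.
move=> e_gt0 mu_full; have mB := measurable_metric_ball x e.
have mB_gt0 : 0 < fine (mu (ball x e)).
  have mB_gt0 : (0 < mu (ball x e))%E.
    apply: mu_full; first exact: metric_ball_open.
    by exists x; exact: ballxx.
  by rewrite fine_gt0// mB_gt0 ltey_eq fin_num_measure.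
apply: (@lt_le_trans _ _ (a * fine (mu (ball x e)))); first by rewrite mulr_gt0.
have int1 : mu.-integrable setT (EFin \o (\1_(ball x e : set (borel X)) : _ -> R)).
  by apply: integrable_indic => //; rewrite ltey_eq fin_num_measure.
have -> : fine (mu (ball x e)) =
    \int[mu]_y (\1_(ball x e : set (borel X)) y).
  by rewrite /Rintegral integral_indic// setIT.
rewrite -RintegralZl//; apply: le_Rintegral => //.
- exact: (integrableZl measurableT a int1).
- exact: integrable_weighted_indic.
- move=> y _; rewrite ler_wpM2r ?indicE//.
  by have /andP[] := w_bounds y.
Qed.

Lemma mu_rho_ball_le (q : R) (x : X) : full_support mu -> Q mu rho r = q%:E ->
  weighted_mass (ball x (2 * r)) <= q * weighted_mass (ball x (r / 2)).
Proof.
move=> mu_full Qq; have rho2_gt0 : 0 < rho ^+ 2 by rewrite exprn_gt0.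
have m_gt0 : 0 < weighted_mass (ball x (r / 2)).
  by apply: weighted_mass_gt0 => //; rewrite divr_gt0.
have : (mu_rho mu rho (ball x (2 * r)) / mu_rho mu rho (ball x (r / 2)) <=
    Q mu rho r)%E.
  by apply: ereal_sup_ubound; exists x.
rewrite !mu_rho_mass; [|exact: measurable_metric_ball..].
rewrite inver gt_eqF ?mulr_gt0// -EFinM Qq lee_fin ler_pdivrMr ?mulr_gt0//.
by rewrite mulrCA ler_pM2l.
Qed.

Lemma bump_Lfun (x : X) : (bump r x : borel X -> R) \in Lfun mu 2%:E.
Proof.
apply: (Lfun2_bounded mu (measurable_bump r x) (c := 1)) => y.
by rewrite ger0_norm ?bump_ge0 ?bump_le1.
Qed.

Definition test_function (x : X) : V := Lfun_Sub (lee1n 2) (bump_Lfun x).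

Variables (n : nat) (y : 'I_n -> X) (c : 'I_n -> R).
Hypothesis y_sep : forall i j, i != j -> 3 * r <= mdist (y i) (y j).

Let U : V := \sum_i c i *: test_function (y i).

Let UE x : U x = \sum_i c i * bump r (y i) x.
Proof. by rewrite /U Lfun_sumE. Qed.

Let sum_indic_int (e : R) :
  mu.-integrable setT (EFin \o (fun x : borel X =>
    \sum_i w x * (c i ^+ 2 * \1_(ball (y i) e : set (borel X)) x))) /\
  \int[mu]_x (\sum_i w x * (c i ^+ 2 * \1_(ball (y i) e : set (borel X)) x)) =
  \sum_i c i ^+ 2 * weighted_mass (ball (y i) e).
Proof.
have intw i := integrable_weighted_indic (measurable_metric_ball (y i) e).
have intc i : mu.-integrable setT (EFin \o (fun x : borel X =>
    w x * (c i ^+ 2 * \1_(ball (y i) e : set (borel X)) x))).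
  under [X in EFin \o X]funext => x do rewrite mulrCA.
  exact: (integrableZl measurableT (c i ^+ 2) (intw i)).
have [intS ->] := Rintegral_sum (index_enum 'I_n) intc.
split=> //; apply: eq_bigr => i _.
rewrite -RintegralZl//; first by apply: eq_Rintegral => x _; rewrite mulrCA.
Qed.

Lemma test_norm_ge :
  4^-1 * (\sum_i c i ^+ 2 * weighted_mass (ball (y i) (r / 2))) <= ip U U.
Proof.
have [intS <-] := sum_indic_int (r / 2).
rewrite -RintegralZl//; apply: le_Rintegral => //.
- exact: (integrableZl measurableT 4^-1 intS).
- apply: (integrable_weight mw a_gt0 w_bounds); exact: Lfun2_integrable_mul.
- move=> x _; rewrite -mulr_sumr mulrCA -expr2 UE ler_wpM2l ?fine_ge0//.
  exact: bump_sum_sqr.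
Qed.

Lemma test_energy_le :
  2 * rho ^+ 2 * ip (A U) U <=
  rho ^+ 2 / r ^+ 2 * (\sum_i c i ^+ 2 * weighted_mass (ball (y i) (2 * r))).
Proof.
have [intS <-] := sum_indic_int (2 * r).
rewrite (nbh_operator_energy mE N_sym).
(* The bound of [bump_sum_sqrB] involves one endpoint; averaging it with the bound for the exchanged
   endpoints gives [f x + f x'], hence the division by 2. *)
pose f (x : borel X) := rho ^+ 2 / r ^+ 2 / 2 *
  (\sum_i c i ^+ 2 * \1_(ball (y i) (2 * r) : set (borel X)) x).
have intf : mu.-integrable setT (EFin \o f).
  have [|intS1 _] := Rintegral_sum (index_enum 'I_n) (mu := mu)
    (g := fun i x => c i ^+ 2 * \1_(ball (y i) (2 * r) : set (borel X)) x).
    move=> i; apply: (integrableZl measurableT (c i ^+ 2)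
      (f := EFin \o (\1_(ball (y i) (2 * r) : set (borel X)) : _ -> R))).
    have mB := measurable_metric_ball (y i) (2 * r).
    by apply: integrable_indic => //; rewrite ltey_eq fin_num_measure.
  exact: (integrableZl measurableT (rho ^+ 2 / r ^+ 2 / 2) intS1).
apply: (le_trans (energy_le mE N_sym intf _)).
  move=> x x' xx'; rewrite !UE -sumrB.
  under eq_bigr => i _ do rewrite -mulrBr.
  have := xx'; rewrite /N ball_mdistE.
  move=> /(bump_sum_sqrB r_gt0 c y_sep rho_le_r) h1.
  have := N_sym xx'; rewrite /N ball_mdistE.
  move=> /(bump_sum_sqrB r_gt0 c y_sep rho_le_r) h2.
  have h3 : (\sum_i c i * (bump r (y i) x' - bump r (y i) x)) ^+ 2 =
      (\sum_i c i * (bump r (y i) x - bump r (y i) x')) ^+ 2.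
    rewrite -sqrrN -sumrN; congr (_ ^+ 2); apply: eq_bigr => i _; ring.
  rewrite h3 in h2; rewrite /f; move: h1 h2.
  move: (_ / _) => k; set s := \sum_i _; set s1 := \sum_i _; set s2 := \sum_i _.
  lra.
rewrite -!RintegralZl//; last first.
  exact: (integrable_weight mw a_gt0 w_bounds intf).
apply: le_Rintegral => //.
- have := integrable_weight mw a_gt0 w_bounds intf.
  exact: (integrableZl measurableT 2).
- exact: (integrableZl measurableT (rho ^+ 2 / r ^+ 2) intS).
- move=> x _; rewrite -mulr_sumr /f le_eqVlt; apply/orP; left; apply/eqP.
  by rewrite -/(w x); field; rewrite gt_eqF.
Qed.

Lemma test_rayleigh (q : R) : full_support mu -> 0 <= q -> Q mu rho r = q%:E ->
  (exists i, c i != 0) ->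
  0 < ip U U /\ ip (A U) U <= 4 * q * r ^- 2 * ip U U.
Proof.
move=> mu_full q_ge0 Qq [i0 ci0].
pose J := \sum_i c i ^+ 2 * weighted_mass (ball (y i) (r / 2)).
have term_ge0 i : 0 <= c i ^+ 2 * weighted_mass (ball (y i) (r / 2)).
  by rewrite mulr_ge0 ?sqr_ge0// ltW// weighted_mass_gt0// divr_gt0.
have J_gt0 : 0 < J.
  rewrite /J (bigD1 i0)//= ltr_pwDl ?sumr_ge0// mulr_gt0//.
    by rewrite exprn_even_gt0.
  by rewrite weighted_mass_gt0// divr_gt0.
have JU : 4^-1 * J <= ip U U := test_norm_ge.
have rho2_gt0 : 0 < rho ^+ 2 by rewrite exprn_gt0.
have r2_gt0 : 0 < r ^+ 2 by rewrite exprn_gt0.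
split; first by apply: lt_le_trans JU; rewrite mulr_gt0.
have J2 : \sum_i c i ^+ 2 * weighted_mass (ball (y i) (2 * r)) <= q * J.
  rewrite /J mulr_sumr; apply: ler_sum => i _.
  by rewrite mulrCA ler_wpM2l ?sqr_ge0// mu_rho_ball_le.
have AU : 2 * rho ^+ 2 * ip (A U) U <= rho ^+ 2 / r ^+ 2 * (q * J).
  by apply: (le_trans test_energy_le); rewrite ler_wpM2l// divr_ge0// ltW.
have c_gt0 : 0 < 2 * rho ^+ 2 by rewrite mulr_gt0.
rewrite -(ler_pM2l c_gt0); apply: (le_trans AU).
(* [test_norm_ge] gives [J <= 4 * ip U U], within the [8 * ip U U] allowed here. *)
have -> : 2 * rho ^+ 2 * (4 * q / r ^+ 2 * ip U U) =
    rho ^+ 2 / r ^+ 2 * (q * (8 * ip U U)).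
  by field; rewrite gt_eqF.
rewrite ler_wpM2l ?divr_ge0 ?(ltW rho2_gt0) ?(ltW r2_gt0)// ler_wpM2l//.
lra.
Qed.

End test_functions.

Theorem theorem7p2 (R : realType) (X : pmetricType R)
    (X_compact : compact [set: X])
    (mu : {finite_measure set (borel X) -> \bar R})
    (mu_full : full_support mu)
    (rho : R) (rho_gt0 : 0 < rho) (r : R) (rho_le_r : rho <= r) :
  (lambda_ mu (rho_laplacian mu rho) (packing_number X (3 * r))
     <= 4%:E * Q mu rho r * (r ^- 2)%:E)%E.
Proof.
have r_gt0 : 0 < r by exact: lt_le_trans rho_le_r.
have [N_gt0 [f f_sep]] := packing_numberP X_compact (mulr_gt0 (ltr0Sn R 2) r_gt0).
have [a a_gt0 ball_ge] := ball_measure_lower_bound X_compact mu_full rho_gt0.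
have Q_ge0 : (0 <= Q mu rho r)%E.
  apply: le_ereal_sup_tmp; exists (mu_rho mu rho (ball point (2 * r)) /
    mu_rho mu rho (ball point (r / 2)))%E; first by exists point.
  rewrite mule_ge0 ?inve_ge0//; apply: integral_ge0 => x _;
    by rewrite mule_ge0 ?lee_fin ?sqr_ge0.
have r2_gt0 : 0 < r ^- 2 by rewrite invr_gt0 exprn_gt0.
(* If [Q] is [+oo] so is the right-hand side; [-oo] is excluded by [Q_ge0]. *)
case Qq : (Q mu rho r) Q_ge0 => [q| |] // q_ge0; last first.
  by rewrite gt0_muley ?lte_fin// gt0_mulye ?lte_fin ?leey.
rewrite -!EFinM; rewrite lee_fin in q_ge0.
pose N (x : borel X) : set (borel X) := ball (x : X) rho.
have mE := measurable_near_diagonal X_compact rho.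
have N_sym (x y : borel X) : N x y -> N y x by exact: ball_sym.
have mw := nbh_weight_measurable mu (N := N) mE.
have w_bounds := nbh_weight_bounds (N := N) mE ball_ge.
pose w x := fine (mu (N x)).
pose A := nbh_operator (N := N) mE rho_gt0 a_gt0 ball_ge.
pose u (i : 'I_(packing_number X (3 * r))) :=
  test_function mu rho_gt0 rho_le_r (f i).
apply: (@lambda_le _ _ _ mu _ A (weighted_ip w) _ _ _ _ _ _ _ _ _ _ _ _ _ _ u).
- exact: nbh_operatorE.
- exact: weighted_ip_sb mw a_gt0 w_bounds.
- exact: weighted_ip_ge0 a_gt0 w_bounds.
- exact: nbh_operator_sa.
- exact: weighted_ip_eq0 mw a_gt0 w_bounds.
- exact: nbh_operator_ge0.
- exact: nbh_operator_le.
- exact: weighted_ip_complete mw a_gt0 w_bounds.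
- exact: weighted_ip_le mw a_gt0 w_bounds.
- exact: norm_le_weighted_ip mw a_gt0 w_bounds.
- exact: N_gt0.
- move=> c c0; apply: (test_rayleigh X_compact rho_gt0 a_gt0 ball_ge) => //.
  by move=> i j ij; exact: f_sep.
Qed.
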